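(* Let $f\colon\mathcal E\to\mathcal B$ be an outer (resp. inner) fibration of $\infty$-bicategories and let $x,y$ be two vertices of $\mathcal E$. Then the map of marked simplicial sets $$f_*\colon\mathrm{Hom}^{\triangleright}_{\mathcal E}(x,y)\to\mathrm{Hom}^{\triangleright}_{\mathcal B}(f(x),f(y))$$ is a marked left (resp. right) fibration. Furthermore, if $e\colon x'\to y$ is an $f$-cartesian edge with $f(x')=f(x)$, then post-composition with $e$ induces an equivalence between the mapping space $\mathrm{Hom}_{\mathcal E_{f(x)}}(x,x')$ and the fiber of $f_*$ over $f(e)$, where $\mathcal E_{f(x)}$ denotes the fiber of $f$ over $f(x)$.
   Context: A scaled simplicial set is a pair $(X,T_X)$ of a simplicial set and a set $T_X$ of 2-simplices (thin triangles) containing the degenerate ones; maps preserve thin triangles. $(X,T)$ means: thin triangles are those of $T$ and the degenerate ones; $T_{|L}$ is the set of triangles of $L\subseteq X$ lying in $T$. An $\infty$-bicategory is a scaled simplicial set with the extension property against: (i) $(\Lambda^n_i,\{\Delta^{\{i-1,i,i+1\}}\}_{|\Lambda^n_i})\to(\Delta^n,\{\Delta^{\{i-1,i,i+1\}}\})$, $0<i<n$; (ii) $(\Delta^4,T)\to(\Delta^4,T\cup\{\Delta^{\{0,3,4\}},\Delta^{\{0,1,4\}}\})$, $T=\{\Delta^{\{0,2,4\}},\Delta^{\{1,2,3\}},\Delta^{\{0,1,3\}},\Delta^{\{1,3,4\}},\Delta^{\{0,1,2\}}\}$; (iii) $(\Lambda^n_0\coprod_{\Delta^{\{0,1\}}}\Delta^0,\{\Delta^{\{0,1,n\}}\})\to(\Delta^n\coprod_{\Delta^{\{0,1\}}}\Delta^0,\{\Delta^{\{0,1,n\}}\})$,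 $n\ge3$. A weak fibration is a map of scaled simplicial sets with the right lifting property against the maps (i) and against $(\Lambda^n_0\coprod_{\Delta^{\{0,1\}}}\Delta^0,\{\Delta^{\{0,1,n\}}\}_{|\Lambda^n_0})\subseteq(\Delta^n\coprod_{\Delta^{\{0,1\}}}\Delta^0,\{\Delta^{\{0,1,n\}}\})$ and $(\Lambda^n_n\coprod_{\Delta^{\{n-1,n\}}}\Delta^0,\{\Delta^{\{0,n-1,n\}}\}_{|\Lambda^n_n})\subseteq(\Delta^n\coprod_{\Delta^{\{n-1,n\}}}\Delta^0,\{\Delta^{\{0,n-1,n\}}\})$, $n\ge2$. It detects thin triangles if a triangle of the domain is thin iff its image is. A weak fibration that detects thin triangles is an inner fibration if its underlying map is an inner fibration of simplicial sets, and an outer fibration if its underlying map has the right lifting property against $\Lambda^n_0\coprod_{\Delta^{\{0,1\}}}\Delta^0\subseteq\Delta^n\coprod_{\Delta^{\{0,1\}}}\Delta^0$ and $\Lambda^n_n\coprod_{\Delta^{\{n-1,n\}}}\Delta^0\subseteq\Delta^n\coprod_{\Delta^{\{n-1,n\}}}\Delta^0$, $n\ge2$. Fibers of inner/outer fibrations have all triangles thin and are regarded as $\infty$-categories. An edge $e$ is $f$-cartesian if every square from $(\Lambda^n_n,\{\Delta^{\{0,n-1,n\}}\}_{|\Lambda^n_n})\subseteq(\Delta^n,\{\Delta^{\{0,n-1,n\}}\})$, $n\ge2$, to $f$ whose top map sends $\Delta^{\{n-1,n\}}$ to $e$ has a lift. For an $\infty$-bicategory $\mathcal C$ and vertices $x,y$,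 $\mathrm{Hom}^{\triangleright}_{\mathcal C}(x,y)$ is the marked simplicial set whose $n$-simplices are maps $\Delta^n\ast\Delta^0\to\mathcal C$ of simplicial sets which are constant with value $x$ on $\Delta^n$ and send $\Delta^0$ to $y$; an edge is marked iff the corresponding triangle of $\mathcal C$ is thin. (It is the fiber over $x$ of the slice $\mathcal C_{/y}$ and is a model for the mapping $\infty$-category.) A marked left (resp. right) fibration is a map of marked simplicial sets which detects marked edges and is a left (resp. right) fibration on underlying simplicial sets. Post-composition with an edge $e\colon x'\to y$ of $\mathcal E$ is the map, well defined up to homotopy, given by the zig-zag $\mathrm{Hom}^{\triangleright}_{\mathcal E}(x,x')\xleftarrow{\simeq}(\mathcal E_{/e^\sharp})_x\to\mathrm{Hom}^{\triangleright}_{\mathcal E}(x,y)$, where $n$-simplices of $(\mathcal E_{/e^\sharp})_x$ are maps $\Delta^n\ast\Delta^1\to\mathcal E$ that are constant at $x$ on $\Delta^n$, equal to $e$ on $\Delta^1$ and thin on all triangles $\{i\}\ast\Delta^1$. *)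

(* Defs.v *)
From HB Require Import structures.
From mathcomp Require Import all_boot.
From mathcomp Require Import boolp classical_sets.
From Stdlib Require Import Relations.

Set Implicit Arguments.
Unset Strict Implicit.
Unset Printing Implicit Defensive.

Local Open Scope classical_set_scope.

(* Order-preserving maps from [m] = {0, ..., m} to [n] = {0, ..., n} *)

Record omap (m n : nat) := OMap {
  omap_fun :> {ffun 'I_m.+1 -> 'I_n.+1};
  omap_homo : [forall i : 'I_m.+1, forall j : 'I_m.+1, (i <= j) ==> (omap_fun i <= omap_fun j)] }.

HB.instance Definition _ (m n : nat) := [isSub for @omap_fun m n].

Lemma omapP m n (f g : omap m n) : f =1 g -> f = g.
Proof. by move=> fg; apply/val_inj/ffunP. Qed.

Lemma omap_le m n (f : omap m n) (i j : 'I_m.+1) : i <= j -> f i <= f j.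
Proof. by move: i j => i j; have /forallP/(_ i)/forallP/(_ j)/implyP := omap_homo f. Qed.

Lemma mk_omap_subproof m n (f : 'I_m.+1 -> 'I_n.+1) :
  (forall i j : 'I_m.+1, i <= j -> f i <= f j) ->
  [forall i : 'I_m.+1, forall j : 'I_m.+1, (i <= j) ==> ([ffun k => f k] i <= [ffun k => f k] j)].
Proof.
by move=> hf; apply/forallP => i; apply/forallP => j; apply/implyP; rewrite !ffunE; apply: hf.
Qed.

Definition mk_omap m n (f : 'I_m.+1 -> 'I_n.+1)
    (hf : forall i j : 'I_m.+1, i <= j -> f i <= f j) : omap m n :=
  OMap (mk_omap_subproof hf).

Lemma mk_omapE m n (f : 'I_m.+1 -> 'I_n.+1) hf i : @mk_omap m n f hf i = f i.
Proof. by rewrite /= ffunE. Qed.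

Definition oid n : omap n n := @mk_omap n n id (fun _ _ h => h).

Definition ocomp m n p (g : omap n p) (f : omap m n) : omap m p :=
  @mk_omap m p (fun i => g (f i)) (fun _ _ h => omap_le g (omap_le f h)).

Definition ocst m n (i : 'I_n.+1) : omap m n :=
  @mk_omap m n (fun=> i) (fun _ _ _ => leqnn i).

(* The join [n] * [k] of ordinals is [n + k.+1]; the next two maps are the
   inclusions of the two factors. *)
Definition ojoinl n k : omap n (n + k.+1) :=
  @mk_omap n (n + k.+1) (@lshift n.+1 k.+1) (fun _ _ h => h).

Lemma ojoinr_subproof n k (i j : 'I_k.+1) :
  i <= j -> @rshift n.+1 k.+1 i <= @rshift n.+1 k.+1 j.
Proof. by rewrite /= leq_add2l. Qed.

Definition ojoinr n k : omap k (n + k.+1) :=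
  @mk_omap k (n + k.+1) (@rshift n.+1 k.+1) (@ojoinr_subproof n k).

Definition ojoin_fun m n k (a : omap m n) (i : 'I_(m.+1 + k.+1)) : 'I_(n.+1 + k.+1) :=
  match split i with
  | inl j => lshift k.+1 (a j)
  | inr j => rshift n.+1 j
  end.

Lemma ojoin_subproof m n k (a : omap m n) (i j : 'I_(m.+1 + k.+1)) :
  i <= j -> @ojoin_fun m n k a i <= @ojoin_fun m n k a j.
Proof.
rewrite /ojoin_fun; case: splitP => i' ->; case: splitP => j' ->.
- exact: (@omap_le _ _ a).
- by move=> _; apply: leq_trans (ltnW (ltn_ord (a i'))) (leq_addr _ _).
- by move=> h; have := ltn_ord j'; rewrite ltnNge (leq_trans (leq_addr _ _) h).
- by rewrite /= !leq_add2l.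
Qed.

(* [ojoin k a] is a * id : [m] * [k] -> [n] * [k]. *)
Definition ojoin k m n (a : omap m n) : omap (m + k.+1) (n + k.+1) :=
  @mk_omap (m + k.+1) (n + k.+1) (@ojoin_fun m n k a) (@ojoin_subproof m n k a).

Lemma ocompE m n p (g : omap n p) (f : omap m n) i : ocomp g f i = g (f i).
Proof. exact: mk_omapE. Qed.

Lemma ojoin_l k m n (a : omap m n) i : ojoin k a (@lshift m.+1 k.+1 i) = @lshift n.+1 k.+1 (a i).
Proof. by rewrite mk_omapE /ojoin_fun -[lshift _ i]/(unsplit (inl i)) unsplitK. Qed.

Lemma ojoin_r k m n (a : omap m n) i : ojoin k a (@rshift m.+1 k.+1 i) = @rshift n.+1 k.+1 i.
Proof. by rewrite mk_omapE /ojoin_fun -[rshift _ i]/(unsplit (inr i)) unsplitK. Qed.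

Lemma ojoin_ext n k p (f g : omap (n + k.+1) p) :
  (forall i, f (@lshift n.+1 k.+1 i) = g (@lshift n.+1 k.+1 i)) ->
  (forall i, f (@rshift n.+1 k.+1 i) = g (@rshift n.+1 k.+1 i)) -> f = g.
Proof.
move=> hl hr; apply: omapP => i; rewrite -[i]/(i : 'I_(n.+1 + k.+1)).
rewrite -(splitK (i : 'I_(n.+1 + k.+1))).
by case: (split _) => j; [exact: hl | exact: hr].
Qed.

Lemma ojoin_id k n : ojoin k (oid n) = oid (n + k.+1).
Proof. by apply: ojoin_ext => i; rewrite ?ojoin_l ?ojoin_r !mk_omapE. Qed.

Lemma ojoin_comp k m n p (g : omap n p) (f : omap m n) :
  ojoin k (ocomp g f) = ocomp (ojoin k g) (ojoin k f).
Proof. by apply: ojoin_ext => i; rewrite ?ocompE ?ojoin_l ?ojoin_r // ocompE. Qed.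

Lemma ojoinlE n k i : ojoinl n k i = @lshift n.+1 k.+1 i.
Proof. exact: mk_omapE. Qed.

Lemma ojoinrE n k i : ojoinr n k i = @rshift n.+1 k.+1 i.
Proof. exact: mk_omapE. Qed.

Lemma ojoin_ojoinl k m n (a : omap m n) :
  ocomp (ojoin k a) (ojoinl m k) = ocomp (ojoinl n k) a.
Proof. by apply: omapP => i; rewrite !ocompE !ojoinlE ojoin_l. Qed.

Lemma ojoin_ojoinr k m n (a : omap m n) :
  ocomp (ojoin k a) (ojoinr m k) = ojoinr n k.
Proof. by apply: omapP => i; rewrite ocompE !ojoinrE ojoin_r. Qed.

Lemma ocomp_ocst m n p (g : omap n p) (i : 'I_n.+1) :
  ocomp g (ocst m i) = ocst m (g i).
Proof. by apply: omapP => j; rewrite ocompE !mk_omapE. Qed.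

Record sset := SSet {
  simplex :> nat -> Type;
  act : forall m n, omap m n -> simplex n -> simplex m;
  act_id : forall n (s : simplex n), act (oid n) s = s;
  act_comp : forall m n p (g : omap n p) (f : omap m n) (s : simplex p),
    act (ocomp g f) s = act f (act g s) }.

Record smap (X Y : sset) := SMap {
  smap_fun :> forall n, X n -> Y n;
  smap_act : forall m n (a : omap m n) (s : X n),
    smap_fun (act a s) = act a (smap_fun s) }.

Definition sid (X : sset) : smap X X :=
  @SMap X X (fun _ s => s) (fun _ _ _ _ => erefl).

Lemma scomp_subproof X Y Z (g : smap Y Z) (f : smap X Y) m n (a : omap m n) (s : X n) :
  g m (f m (act a s)) = act a (g n (f n s)).
Proof. by rewrite !smap_act. Qed.

Definition scomp X Y Z (g : smap Y Z) (f : smap X Y) : smap X Z :=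
  SMap (scomp_subproof g f).

Definition cst (X : sset) n (v : X 0) : X n := act (ocst n (@ord0 0)) v.

Definition source (X : sset) (e : X 1) : X 0 := act (ocst 0 ord0) e.
Definition target (X : sset) (e : X 1) : X 0 := act (ocst 0 ord_max) e.

Lemma act_cst (X : sset) m n (a : omap m n) (v : X 0) : act a (cst n v) = cst m v.
Proof.
by rewrite /cst -act_comp; congr act; apply: omapP => i; rewrite ocompE !mk_omapE.
Qed.

Lemma cst0 (X : sset) (v : X 0) : cst 0 v = v.
Proof.
rewrite -[RHS]act_id /cst; congr act; apply: omapP => i.
by rewrite !mk_omapE [i]ord1.
Qed.

Lemma smap_cst X Y (f : smap X Y) n (v : X 0) : f n (cst n v) = cst n (f 0 v).
Proof. exact: smap_act. Qed.

Lemma simp_act_id n m (s : omap m n) : ocomp s (oid m) = s.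
Proof. by apply: omapP => i; rewrite ocompE mk_omapE. Qed.

Lemma simp_act_comp n m p q (g : omap p q) (f : omap m p) (s : omap q n) :
  ocomp s (ocomp g f) = ocomp (ocomp s g) f.
Proof. by apply: omapP => i; rewrite !ocompE. Qed.

Definition simp (n : nat) : sset :=
  @SSet (fun m => omap m n) (fun _ _ a s => ocomp s a)
    (@simp_act_id n) (fun m p q => @simp_act_comp n m p q).

Record subc (X : sset) := SubC {
  subc_set :> forall m, X m -> Prop;
  subc_act : forall m n (a : omap m n) (s : X n), subc_set s -> subc_set (act a s) }.

Lemma sub_act_id X (A : subc X) n (s : {s : X n | A n s}) :
  exist (A n) (act (oid n) (sval s)) (subc_act (oid n) (proj2_sig s)) = s.
Proof. by case: s => s hs; apply: eq_exist => /=; rewrite act_id. Qed.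

Lemma sub_act_comp X (A : subc X) m n p (g : omap n p) (f : omap m n)
    (s : {s : X p | A p s}) :
  exist (A m) (act (ocomp g f) (sval s)) (subc_act (ocomp g f) (proj2_sig s)) =
  exist (A m) (act f (act g (sval s))) (subc_act f (subc_act g (proj2_sig s))).
Proof. by apply: eq_exist; rewrite act_comp. Qed.

Definition sub (X : sset) (A : subc X) : sset :=
  @SSet (fun m => {s : X m | A m s})
    (fun m n a s => exist (A m) (act a (sval s)) (subc_act a (proj2_sig s)))
    (@sub_act_id X A) (@sub_act_comp X A).

Definition incl (X : sset) (A : subc X) : smap (sub A) X :=
  @SMap (sub A) X (fun _ s => sval s) (fun _ _ _ _ => erefl).

Lemma sub_map_subproof X Y (f : smap X Y) (A : subc X) (B : subc Y)
    (h : forall m (s : X m), A m s -> B m (f m s)) m n (a : omap m n) (s : sub A n) :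
  exist (B m) (f m (sval (act a s))) (h m _ (proj2_sig (act a s))) =
  @act (sub B) m n a (exist (B n) (f n (sval s)) (h n _ (proj2_sig s))).
Proof. by apply: eq_exist => /=; rewrite smap_act. Qed.

Definition sub_map X Y (f : smap X Y) (A : subc X) (B : subc Y)
    (h : forall m (s : X m), A m s -> B m (f m s)) : smap (sub A) (sub B) :=
  @SMap (sub A) (sub B)
    (fun m s => exist (B m) (f m (sval s)) (h m _ (proj2_sig s)))
    (@sub_map_subproof X Y f A B h).

Lemma preim_subproof X Y (f : smap X Y) (B : subc Y) m n (a : omap m n) (s : X n) :
  B n (f n s) -> B m (f m (act a s)).
Proof. by rewrite smap_act; apply: subc_act. Qed.

Definition preim X Y (f : smap X Y) (B : subc Y) : subc X :=
  @SubC X (fun m => [set s | B m (f m s)]) (@preim_subproof X Y f B).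

Lemma point_subproof (X : sset) (v : X 0) m n (a : omap m n) (s : X n) :
  s = cst n v -> act a s = cst m v.
Proof. by move=> ->; rewrite act_cst. Qed.

Definition point (X : sset) (v : X 0) : subc X :=
  @SubC X (fun m => [set s | s = cst m v]) (@point_subproof X v).

Definition fiber X Y (f : smap X Y) (v : Y 0) : sset := sub (preim f (point v)).

Definition fiber_vertex X Y (f : smap X Y) (v : Y 0) (x : X 0) (h : f 0 x = v) :
    fiber f v 0 :=
  exist (preim f (point v) 0) x (etrans h (esym (cst0 v))).

Lemma horn_subproof n (i : 'I_n.+1) m p (a : omap m p) (s : simp n p) :
  (exists2 j : 'I_n.+1, j != i & forall k, s k != j) ->
  exists2 j : 'I_n.+1, j != i & forall k, @act (simp n) m p a s k != j.
Proof. by case=> j ji hj; exists j => // k; rewrite ocompE. Qed.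

(* The simplices of the horn Lambda^n_i are those of Delta^n which miss some
   vertex other than i. *)
Definition horn n (i : 'I_n.+1) : subc (simp n) :=
  @SubC (simp n)
    (fun m => [set s : omap m n | exists2 j : 'I_n.+1, j != i & forall k, s k != j])
    (@horn_subproof n i).

Lemma face_subproof n (vs : seq nat) m p (a : omap m p) (s : simp n p) :
  (forall k, (s k : nat) \in vs) ->
  forall k, (@act (simp n) m p a s k : nat) \in vs.
Proof. by move=> h k; rewrite ocompE. Qed.

(* Delta^S, for the set S of vertices listed in vs *)
Definition face n (vs : seq nat) : subc (simp n) :=
  @SubC (simp n) (fun m => [set s : omap m n | forall k, (s k : nat) \in vs])
    (@face_subproof n vs).

(* The singletons {Delta^{i,j}} and {Delta^{i,j,k}} *)
Definition edge n (i j : nat) : set (simp n 1) :=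
  [set s : omap 1 n | s ord0 = i :> nat /\ s ord_max = j :> nat].
Definition tri n (i j k : nat) : set (simp n 2) :=
  [set s : omap 2 n |
    [/\ s ord0 = i :> nat, s (inord 1) = j :> nat & s ord_max = k :> nat]].

Arguments edge : clear implicits.
Arguments tri : clear implicits.

Lemma prod_act_id (X Y : sset) n (s : X n * Y n) :
  (act (oid n) s.1, act (oid n) s.2) = s.
Proof. by case: s => s t; rewrite !act_id. Qed.

Lemma prod_act_comp (X Y : sset) m n p (g : omap n p) (f : omap m n) (s : X p * Y p) :
  (act (ocomp g f) s.1, act (ocomp g f) s.2) =
  (act f (act g s.1), act f (act g s.2)).
Proof. by rewrite !act_comp. Qed.

Definition sprod (X Y : sset) : sset :=
  @SSet (fun n => (X n * Y n)%type) (fun _ _ a s => (act a s.1, act a s.2))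
    (@prod_act_id X Y) (@prod_act_comp X Y).

(* Pushouts of X <- A -> Y are computed degreewise: the n-simplices are the
   classes of X_n + Y_n for the equivalence relation generated by f a ~ g a. *)

Definition glue (A X Y : sset) (f : smap A X) (g : smap A Y) n :
    relation (X n + Y n) :=
  clos_refl_sym_trans _
    (fun u v => exists a : A n, u = inl (f n a) /\ v = inr (g n a)).

Definition sum_act (X Y : sset) m n (a : omap m n) (u : X n + Y n) : X m + Y m :=
  match u with inl s => inl (act a s) | inr s => inr (act a s) end.

Lemma glue_act A X Y (f : smap A X) (g : smap A Y) m n (a : omap m n) u v :
  glue f g u v -> glue f g (sum_act a u) (sum_act a v).
Proof.
elim=> {u v} [u v [s [-> ->]]|u|u v _|u v w _ uv _ vw].
- by apply: rst_step; exists (act a s); rewrite !smap_act.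
- exact: rst_refl.
- exact: rst_sym.
- exact: rst_trans uv vw.
Qed.

Definition pushout_simplex A X Y (f : smap A X) (g : smap A Y) n : Type :=
  {C : set (X n + Y n) | exists u, C = [set v | glue f g u v]}.

Definition pclass A X Y (f : smap A X) (g : smap A Y) n (u : X n + Y n) :
    pushout_simplex f g n :=
  exist _ [set v | glue f g u v] (ex_intro _ u erefl).

Lemma pclassP A X Y (f : smap A X) (g : smap A Y) n (u v : X n + Y n) :
  pclass f g u = pclass f g v <-> glue f g u v.
Proof.
split=> [[] /(congr1 (fun C => C v)) /= -> | uv]; first exact: rst_refl.
apply: eq_exist; apply/seteqP; split=> w /= h.
  exact: rst_trans (rst_sym _ _ _ _ uv) h.
exact: rst_trans uv h.
Qed.

Lemma pclass_surj A X Y (f : smap A X) (g : smap A Y) n (C : pushout_simplex f g n) :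
  exists u, C = pclass f g u.
Proof. by case: C => C [u hu]; exists u; apply: eq_exist. Qed.

Lemma pushout_act_subproof A X Y (f : smap A X) (g : smap A Y) m n (a : omap m n)
    (C : pushout_simplex f g n) :
  exists u, [set v | exists2 w, sval C w & glue f g (sum_act a w) v] =
            [set v | glue f g u v].
Proof.
have [u ->] := pclass_surj C; exists (sum_act a u).
apply/seteqP; split=> v /= => [[w uw]|h]; last by exists u => //; exact: rst_refl.
by apply: rst_trans; exact: glue_act.
Qed.

Definition pushout_act A X Y (f : smap A X) (g : smap A Y) m n (a : omap m n)
    (C : pushout_simplex f g n) : pushout_simplex f g m :=
  exist _ [set v | exists2 w, sval C w & glue f g (sum_act a w) v]
    (pushout_act_subproof a C).

Lemma pushout_actE A X Y (f : smap A X) (g : smap A Y) m n (a : omap m n) u :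
  pushout_act a (pclass f g u) = pclass f g (sum_act a u).
Proof.
apply: eq_exist; apply/seteqP; split=> v /= => [[w uw]|h].
  by apply: rst_trans; exact: glue_act.
by exists u => //; exact: rst_refl.
Qed.

Lemma pushout_act_id A X Y (f : smap A X) (g : smap A Y) n
    (C : pushout_simplex f g n) : pushout_act (oid n) C = C.
Proof.
by have [[s|s] ->] := pclass_surj C; rewrite pushout_actE /= act_id.
Qed.

Lemma pushout_act_comp A X Y (f : smap A X) (g : smap A Y) m n p (b : omap n p)
    (a : omap m n) (C : pushout_simplex f g p) :
  pushout_act (ocomp b a) C = pushout_act a (pushout_act b C).
Proof.
by have [[s|s] ->] := pclass_surj C; rewrite !pushout_actE /= act_comp.
Qed.

Definition pushout A X Y (f : smap A X) (g : smap A Y) : sset :=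
  @SSet (pushout_simplex f g) (@pushout_act A X Y f g)
    (@pushout_act_id A X Y f g) (@pushout_act_comp A X Y f g).

Lemma pinl_subproof A X Y (f : smap A X) (g : smap A Y) m n (a : omap m n) (s : X n) :
  pclass f g (inl (act a s)) = pushout_act a (pclass f g (inl s)).
Proof. by rewrite pushout_actE. Qed.

Definition pinl A X Y (f : smap A X) (g : smap A Y) : smap X (pushout f g) :=
  @SMap X (pushout f g) (fun n s => pclass f g (inl s)) (@pinl_subproof A X Y f g).

Lemma to_pt_subproof X m n (a : omap m n) (s : X n) :
  ocst m (@ord0 0) = ocomp (ocst n (@ord0 0)) a.
Proof. by apply: omapP => i; rewrite ocompE !mk_omapE. Qed.

Definition to_pt (X : sset) : smap X (simp 0) :=
  @SMap X (simp 0) (fun n _ => ocst n ord0) (@to_pt_subproof X).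

(* The pushout of X along A -> Delta^0 *)
Definition collapse (X : sset) (A : subc X) : sset := pushout (incl A) (to_pt (sub A)).

Definition to_collapse (X : sset) (A : subc X) : smap X (collapse A) :=
  pinl (incl A) (to_pt (sub A)).

Definition collapse_map_sum X Y (f : smap X Y) n (u : X n + simp 0 n) : Y n + simp 0 n :=
  match u with inl s => inl (f n s) | inr s => inr s end.

Lemma collapse_map_glue X Y (f : smap X Y) (B : subc Y) n u v :
  glue (incl (preim f B)) (to_pt (sub (preim f B))) u v ->
  glue (incl B) (to_pt (sub B)) (@collapse_map_sum X Y f n u) (collapse_map_sum f v).
Proof.
elim=> {u v} [u v [s [-> ->]]|u|u v _|u v w _ uv _ vw].
- by apply: rst_step; exists (exist (B n) (f n (sval s)) (proj2_sig s)).
- exact: rst_refl.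
- exact: rst_sym.
- exact: rst_trans uv vw.
Qed.

Lemma collapse_map_class X Y (f : smap X Y) (B : subc Y) n (C : collapse (preim f B) n) :
  exists u, [set v | exists2 w, sval C w &
                glue (incl B) (to_pt (sub B)) (collapse_map_sum f w) v] =
            [set v | glue (incl B) (to_pt (sub B)) u v].
Proof.
have [u ->] := pclass_surj C; exists (collapse_map_sum f u).
apply/seteqP; split=> v /= => [[w uw]|h]; last by exists u => //; exact: rst_refl.
by apply: rst_trans; exact: collapse_map_glue.
Qed.

Definition collapse_map_fun X Y (f : smap X Y) (B : subc Y) n
    (C : collapse (preim f B) n) : collapse B n :=
  exist _ [set v | exists2 w, sval C w &
             glue (incl B) (to_pt (sub B)) (collapse_map_sum f w) v]
    (collapse_map_class C).

Lemma collapse_map_funE X Y (f : smap X Y) (B : subc Y) n (u : X n + simp 0 n) :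
  collapse_map_fun (pclass (incl (preim f B)) (to_pt _) u) =
  pclass (incl B) (to_pt (sub B)) (collapse_map_sum f u).
Proof.
apply: eq_exist; apply/seteqP; split=> v /= => [[w uw]|h].
  by apply: rst_trans; exact: collapse_map_glue.
by exists u => //; exact: rst_refl.
Qed.

Lemma collapse_map_subproof X Y (f : smap X Y) (B : subc Y) m n (a : omap m n)
    (C : collapse (preim f B) n) :
  collapse_map_fun (act a C) = act a (collapse_map_fun C).
Proof.
have [u ->] := pclass_surj C.
rewrite collapse_map_funE /= !pushout_actE collapse_map_funE.
by congr pclass; case: u => s //=; rewrite smap_act.
Qed.

(* The map X +_(f^-1 B) Delta^0 -> Y +_B Delta^0 induced by f *)
Definition collapse_map X Y (f : smap X Y) (B : subc Y) :
    smap (collapse (preim f B)) (collapse B) :=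
  SMap (@collapse_map_subproof X Y f B).

(* A triangle is degenerate iff it is [act s e] for some s : [2] -> [1]. *)
Record scaled := Scaled {
  scaled_sset :> sset;
  thin : set (scaled_sset 2);
  thin_degen : forall (s : omap 2 1) (e : scaled_sset 1), thin (act s e) }.

Record scmap (X Y : scaled) := ScMap {
  scmap_smap :> smap X Y;
  scmap_thin : forall t : X 2, thin t -> thin (scmap_smap 2 t) }.

Lemma scale_subproof (X : sset) (T : set (X 2)) (s : omap 2 1) (e : X 1) :
  T (act s e) \/ exists (s' : omap 2 1) (e' : X 1), act s e = act s' e'.
Proof. by right; exists s, e. Qed.

Definition scale (X : sset) (T : set (X 2)) : scaled :=
  @Scaled X [set t | T t \/ exists (s : omap 2 1) (e : X 1), t = act s e]
    (scale_subproof T).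

Lemma scale_map_subproof X Y (f : smap X Y) (T : set (X 2)) (T' : set (Y 2))
    (h : forall t, T t -> T' (f 2 t)) (t : scale T 2) :
  thin t -> @thin (scale T') (f 2 t).
Proof.
by case=> [/h|[s [e ->]]]; [left | right; exists s, (f 1 e); rewrite smap_act].
Qed.

Definition scale_map X Y (f : smap X Y) (T : set (X 2)) (T' : set (Y 2))
    (h : forall t, T t -> T' (f 2 t)) : scmap (scale T) (scale T') :=
  @ScMap (scale T) (scale T') f (scale_map_subproof h).

Definition scaled_sub (X : scaled) (A : subc X) : scaled :=
  @Scaled (sub A) [set t | thin (sval t)] (fun s e => thin_degen s (sval e)).

Definition scaled_fiber (X Y : scaled) (f : scmap X Y) (v : Y 0) : scaled :=
  scaled_sub (preim f (point v)).

Record marked_sset := Marked {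
  marked_sset_sset :> sset;
  marked : set (marked_sset_sset 1);
  marked_degen : forall (s : omap 1 0) (v : marked_sset_sset 0), marked (act s v) }.

Record mmap (X Y : marked_sset) := MMap {
  mmap_smap :> smap X Y;
  mmap_marked : forall e : X 1, marked e -> marked (mmap_smap 1 e) }.

Definition rlp (A B X Y : sset) (i : smap A B) (f : smap X Y) : Prop :=
  forall (u : smap A X) (v : smap B Y),
    (forall n (a : A n), f n (u n a) = v n (i n a)) ->
    exists h : smap B X,
      (forall n (a : A n), h n (i n a) = u n a) /\
      (forall n (b : B n), f n (h n b) = v n b).

Definition lifts (A B X Y : scaled) (i : scmap A B) (f : scmap X Y)
    (u : scmap A X) (v : scmap B Y) : Prop :=
  exists h : scmap B X,
    (forall n (a : A n), h n (i n a) = u n a) /\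
    (forall n (b : B n), f n (h n b) = v n b).

Definition scaled_rlp (A B X Y : scaled) (i : scmap A B) (f : scmap X Y) : Prop :=
  forall (u : scmap A X) (v : scmap B Y),
    (forall n (a : A n), f n (u n a) = v n (i n a)) -> lifts i f u v.

Definition scaled_ext (A B X : scaled) (i : scmap A B) : Prop :=
  forall u : scmap A X, exists h : scmap B X, forall n (a : A n), h n (i n a) = u n a.

(* (Lambda^n_i, T restricted to Lambda^n_i) -> (Delta^n, T) *)
Definition scaled_horn n (i : 'I_n.+1) (T : set (simp n 2)) :
    scmap (scale (incl (horn i) 2 @^-1` T)) (scale T) :=
  scale_map (f := incl (horn i)) (fun _ h => h).

(* Lambda^n_i +_{Delta^{j,k}} Delta^0 -> Delta^n +_{Delta^{j,k}} Delta^0 *)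
Definition collapsed_horn n (i : 'I_n.+1) (j k : nat) :=
  collapse_map (incl (horn i)) (face n [:: j; k]).

Lemma scaled_collapsed_horn_subproof n (i : 'I_n.+1) (j k : nat) (T : set (simp n 2)) t :
  (to_collapse (preim (incl (horn i)) (face n [:: j; k])) 2 @`
     (incl (horn i) 2 @^-1` T)) t ->
  (to_collapse (face n [:: j; k]) 2 @` T) (collapsed_horn i j k 2 t).
Proof. by case=> s hs <-; exists (sval s) => //; rewrite /= collapse_map_funE. Qed.

Definition scaled_collapsed_horn n (i : 'I_n.+1) (j k : nat) (T : set (simp n 2)) :=
  scale_map (@scaled_collapsed_horn_subproof n i j k T).

Definition saturation_T : set (simp 4 2) :=
  tri 4 0 2 4 `|` tri 4 1 2 3 `|` tri 4 0 1 3 `|` tri 4 1 3 4 `|` tri 4 0 1 2.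

Definition saturation_map :
    scmap (scale saturation_T)
          (scale (saturation_T `|` (tri 4 0 3 4 `|` tri 4 0 1 4))) :=
  scale_map (f := sid (simp 4)) (fun t h => or_introl h).

(* Infinity-bicategories *)
Definition bicategory (X : scaled) : Prop :=
  [/\ forall n (i : 'I_n.+1), 0 < i < n ->
        scaled_ext X (scaled_horn i (tri n i.-1 i i.+1)),
      scaled_ext X saturation_map
    & forall n, 3 <= n ->
        scaled_ext X (scaled_collapsed_horn (@ord0 n) 0 1 (tri n 0 1 n))].

Definition weak_fibration (X Y : scaled) (f : scmap X Y) : Prop :=
  [/\ forall n (i : 'I_n.+1), 0 < i < n ->
        scaled_rlp (scaled_horn i (tri n i.-1 i i.+1)) f,
      forall n, 2 <= n ->
        scaled_rlp (scaled_collapsed_horn (@ord0 n) 0 1 (tri n 0 1 n)) f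
    & forall n, 2 <= n ->
        scaled_rlp (scaled_collapsed_horn (@ord_max n) n.-1 n (tri n 0 n.-1 n)) f].

Definition detects_thin (X Y : scaled) (f : scmap X Y) : Prop :=
  forall t : X 2, thin t <-> thin (f 2 t).

Definition inner_fibration (X Y : scaled) (f : scmap X Y) : Prop :=
  [/\ weak_fibration f, detects_thin f
    & forall n (i : 'I_n.+1), 0 < i < n -> rlp (incl (horn i)) f].

Definition outer_fibration (X Y : scaled) (f : scmap X Y) : Prop :=
  [/\ weak_fibration f, detects_thin f,
      forall n, 2 <= n -> rlp (collapsed_horn (@ord0 n) 0 1) f
    & forall n, 2 <= n -> rlp (collapsed_horn (@ord_max n) n.-1 n) f].

Definition cartesian_edge (X Y : scaled) (f : scmap X Y) (e : X 1) : Prop :=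
  forall n, 2 <= n ->
  forall (u : scmap (scale (incl (horn (@ord_max n)) 2 @^-1` tri n 0 n.-1 n)) X)
         (v : scmap (scale (tri n 0 n.-1 n)) Y),
    (forall m (a : sub (horn (@ord_max n)) m), f m (u m a) = v m (sval a)) ->
    (forall d : sub (horn (@ord_max n)) 1, edge n n.-1 n (sval d) -> u 1 d = e) ->
    lifts (scaled_horn (@ord_max n) (tri n 0 n.-1 n)) f u v.

Definition detects_marked (X Y : marked_sset) (f : mmap X Y) : Prop :=
  forall e : X 1, marked e <-> marked (f 1 e).

Definition marked_left_fibration (X Y : marked_sset) (f : mmap X Y) : Prop :=
  detects_marked f /\
  (forall n (i : 'I_n.+1), 0 <= i < n -> rlp (incl (horn i)) f).

Definition marked_right_fibration (X Y : marked_sset) (f : mmap X Y) : Prop :=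
  detects_marked f /\
  (forall n (i : 'I_n.+1), 0 < i <= n -> rlp (incl (horn i)) f).

Definition elem_homotopic (A B : sset) (f g : smap A B) : Prop :=
  exists H : smap (sprod A (simp 1)) B,
    (forall n (a : A n), H n (a, ocst n ord0) = f n a) /\
    (forall n (a : A n), H n (a, ocst n ord_max) = g n a).

(* For maps into a Kan complex, elementary homotopy is already an equivalence
   relation. *)
Definition homotopic (A B : sset) : relation (smap A B) :=
  clos_refl_sym_trans _ (@elem_homotopic A B).

Definition homotopy_equivalence (A B : sset) (f : smap A B) : Prop :=
  exists g : smap B A, homotopic (scomp g f) (sid A) /\ homotopic (scomp f g) (sid B).

(* The zig-zag A <-p- Z -q-> B, whose left leg is an equivalence, represents
   an equivalence A -> B. When p is an equivalence, the map [phi] below exists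
   and is unique up to homotopy. *)
Definition zigzag_equivalence (A Z B : sset) (p : smap Z A) (q : smap Z B) : Prop :=
  homotopy_equivalence p /\
  exists phi : smap A B, homotopic (scomp phi p) q /\ homotopy_equivalence phi.


Lemma dec_act_id k (X : sset) n (s : X (n + k.+1)) : act (ojoin k (oid n)) s = s.
Proof. by rewrite ojoin_id act_id. Qed.

Lemma dec_act_comp k (X : sset) m n p (g : omap n p) (f : omap m n)
    (s : X (p + k.+1)) :
  act (ojoin k (ocomp g f)) s = act (ojoin k f) (act (ojoin k g) s).
Proof. by rewrite ojoin_comp act_comp. Qed.

(* The n-simplices of [dec k X] are the maps Delta^n * Delta^k -> X, that is, the
   simplices of X of dimension n + k + 1. *)
Definition dec k (X : sset) : sset :=
  @SSet (fun n => X (n + k.+1)) (fun _ _ a s => act (ojoin k a) s)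
    (@dec_act_id k X) (@dec_act_comp k X).

Definition dec_map k X Y (f : smap X Y) : smap (dec k X) (dec k Y) :=
  @SMap (dec k X) (dec k Y) (fun n s => f (n + k.+1) s)
    (fun _ _ a s => smap_act f (ojoin k a) s).

Lemma hom_subproof (C : sset) (x y : C 0) m n (a : omap m n) (s : dec 0 C n) :
  act (ojoinl n 0) s = cst n x /\ act (ojoinr n 0) s = y ->
  act (ojoinl m 0) (@act (dec 0 C) _ _ a s) = cst m x /\
  act (ojoinr m 0) (@act (dec 0 C) _ _ a s) = y.
Proof.
case=> hx hy; rewrite /= -!act_comp ojoin_ojoinl ojoin_ojoinr.
by rewrite act_comp hx act_cst.
Qed.

Definition hom_subc (C : sset) (x y : C 0) : subc (dec 0 C) :=
  @SubC (dec 0 C)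
    (fun n => [set s : C (n + 1) |
       act (ojoinl n 0) s = cst n x /\ act (ojoinr n 0) s = y])
    (@hom_subproof C x y).

Lemma hom_marked_degen (C : scaled) (x y : C 0) (s : omap 1 0)
    (v : sub (hom_subc x y) 0) :
  thin (sval (act s v) : C 2).
Proof. exact: (thin_degen (ojoin 0 s)). Qed.

Definition hom (C : scaled) (x y : C 0) : marked_sset :=
  @Marked (sub (hom_subc x y)) [set e | thin (sval e : C 2)] (@hom_marked_degen C x y).

Lemma hom_map_subproof X Y (f : smap X Y) (x y : X 0) n (s : dec 0 X n) :
  hom_subc x y n s -> hom_subc (f 0 x) (f 0 y) n (dec_map 0 f n s).
Proof. by case=> hx hy; split; rewrite /= -smap_act ?hx ?hy ?smap_cst. Qed.

Definition hom_map (X Y : scaled) (f : scmap X Y) (x y : X 0) :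
    mmap (hom x y) (hom (f 0 x) (f 0 y)) :=
  @MMap (hom x y) (hom (f 0 x) (f 0 y))
    (sub_map (@hom_map_subproof X Y f x y))
    (fun e => @scmap_thin X Y f (sval e)).

Lemma hom_vertex_subproof (C : sset) (x y : C 0) (e : C 1) :
  source e = x -> target e = y -> hom_subc x y 0 (e : dec 0 C 0).
Proof.
move=> <- <-; split; rewrite ?cst0; congr act; apply: omapP => i;
  rewrite !mk_omapE; apply: val_inj => /=; by rewrite [i]ord1.
Qed.

Definition hom_vertex (C : scaled) (x y : C 0) (e : C 1)
    (hs : source e = x) (ht : target e = y) : hom x y 0 :=
  exist (hom_subc x y 0) (e : dec 0 C 0) (hom_vertex_subproof hs ht).

Lemma slice_subproof (C : scaled) (x : C 0) (e : C 1) m n (a : omap m n)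
    (s : dec 1 C n) :
  [/\ act (ojoinl n 1) s = cst n x, act (ojoinr n 1) s = e
    & forall i : 'I_n.+1, thin (act (ojoin 1 (ocst 0 i)) s)] ->
  [/\ act (ojoinl m 1) (@act (dec 1 C) _ _ a s) = cst m x,
      act (ojoinr m 1) (@act (dec 1 C) _ _ a s) = e
    & forall i : 'I_m.+1,
        thin (act (ojoin 1 (ocst 0 i)) (@act (dec 1 C) _ _ a s))].
Proof.
case=> hx he ht; rewrite /= -!act_comp ojoin_ojoinl ojoin_ojoinr.
split=> [|//|i]; first by rewrite act_comp hx act_cst.
by rewrite -act_comp -ojoin_comp ocomp_ocst.
Qed.

Definition slice_subc (C : scaled) (x : C 0) (e : C 1) : subc (dec 1 C) :=
  @SubC (dec 1 C)
    (fun n => [set s : C (n + 2) |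
       [/\ act (ojoinl n 1) s = cst n x, act (ojoinr n 1) s = e
         & forall i : 'I_n.+1, thin (act (ojoin 1 (ocst 0 i)) s : C 2)]])
    (@slice_subproof C x e).

(* The fiber over x of the slice of C over the edge e, e being marked *)
Definition slice (C : scaled) (x : C 0) (e : C 1) : sset := sub (slice_subc x e).

Lemma slice_map_subproof (X Y : scaled) (f : scmap X Y) (x : X 0) (e : X 1) n
    (s : dec 1 X n) :
  slice_subc x e n s -> slice_subc (f 0 x) (f 1 e) n (dec_map 1 f n s).
Proof.
case=> hx he ht; split=> [||i]; rewrite /= -smap_act ?hx ?he ?smap_cst //.
exact/scmap_thin/ht.
Qed.

Definition slice_map (X Y : scaled) (f : scmap X Y) (x : X 0) (e : X 1) :
    smap (slice x e) (slice (f 0 x) (f 1 e)) :=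
  sub_map (@slice_map_subproof X Y f x e).

(* id * (the vertex j of Delta^1) : [n] * [0] -> [n] * [1] *)
Definition ojoin_vertex_fun n (j : 'I_2) (i : 'I_(n.+1 + 1)) : 'I_(n.+1 + 2) :=
  match split i with
  | inl i' => lshift 2 i'
  | inr _ => rshift n.+1 j
  end.

Lemma ojoin_vertex_subproof n (j : 'I_2) (i i' : 'I_(n.+1 + 1)) :
  i <= i' -> ojoin_vertex_fun j i <= ojoin_vertex_fun j i'.
Proof.
rewrite /ojoin_vertex_fun; case: splitP => k ->; case: splitP => k' -> //=.
- by move=> _; apply: leq_trans (ltnW (ltn_ord k)) (leq_addr _ _).
- by move=> h; have := ltn_ord k'; rewrite ltnNge (leq_trans (leq_addr _ _) h).
Qed.

Definition ojoin_vertex n (j : 'I_2) : omap (n + 1) (n + 2) :=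
  @mk_omap (n + 1) (n + 2) (@ojoin_vertex_fun n j) (@ojoin_vertex_subproof n j).

Lemma ojoin_vertex_l n j i : ojoin_vertex n j (@lshift n.+1 1 i) = @lshift n.+1 2 i.
Proof. by rewrite mk_omapE /ojoin_vertex_fun -[lshift _ i]/(unsplit (inl i)) unsplitK. Qed.

Lemma ojoin_vertex_r n j i : ojoin_vertex n j (@rshift n.+1 1 i) = @rshift n.+1 2 j.
Proof. by rewrite mk_omapE /ojoin_vertex_fun -[rshift _ i]/(unsplit (inr i)) unsplitK. Qed.

Lemma ojoin_vertex_nat m n (a : omap m n) j :
  ocomp (ojoin 1 a) (ojoin_vertex m j) = ocomp (ojoin_vertex n j) (ojoin 0 a).
Proof.
apply: ojoin_ext => i; rewrite !ocompE.
  by rewrite ojoin_vertex_l !ojoin_l ojoin_vertex_l.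
by rewrite ojoin_vertex_r !ojoin_r ojoin_vertex_r.
Qed.

Lemma ojoin_vertex_ojoinl n j : ocomp (ojoin_vertex n j) (ojoinl n 0) = ojoinl n 1.
Proof. by apply: omapP => i; rewrite ocompE !ojoinlE ojoin_vertex_l. Qed.

Lemma ojoin_vertex_ojoinr n j :
  ocomp (ojoin_vertex n j) (ojoinr n 0) = ocomp (ojoinr n 1) (ocst 0 j).
Proof. by apply: omapP => i; rewrite !ocompE !ojoinrE ojoin_vertex_r mk_omapE. Qed.

Lemma slice_vertex_subproof (C : scaled) (x v : C 0) (e : C 1) (j : 'I_2)
    (he : act (ocst 0 j) e = v) n (s : dec 1 C n) :
  slice_subc x e n s -> hom_subc x v n (act (ojoin_vertex n j) s : dec 0 C n).
Proof.
case=> hx hs _; split; rewrite -act_comp ?ojoin_vertex_ojoinl ?ojoin_vertex_ojoinr //.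
by rewrite act_comp hs.
Qed.

Lemma dec_vertex_subproof (C : sset) (j : 'I_2) m n (a : omap m n) (s : dec 1 C n) :
  act (ojoin_vertex m j) (act a s) = @act (dec 0 C) _ _ a (act (ojoin_vertex n j) s).
Proof. by rewrite /= -!act_comp ojoin_vertex_nat. Qed.

Definition dec_vertex (C : sset) (j : 'I_2) : smap (dec 1 C) (dec 0 C) :=
  @SMap (dec 1 C) (dec 0 C) (fun n s => act (ojoin_vertex n j) s)
    (@dec_vertex_subproof C j).

(* The legs of the zig-zag hom x x' <- slice x e -> hom x y defining
   post-composition with e : x' -> y. *)
Definition slice_source (C : scaled) (x x' : C 0) (e : C 1) (hs : source e = x') :
    smap (slice x e) (hom x x') :=
  sub_map (f := dec_vertex C ord0) (@slice_vertex_subproof C x x' e ord0 hs).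

Definition slice_target (C : scaled) (x y : C 0) (e : C 1) (ht : target e = y) :
    smap (slice x e) (hom x y) :=
  sub_map (f := dec_vertex C ord_max) (@slice_vertex_subproof C x y e ord_max ht).

Lemma source_smap X Y (f : smap X Y) (e : X 1) : source (f 1 e) = f 0 (source e).
Proof. by rewrite /source smap_act. Qed.

Lemma target_smap X Y (f : smap X Y) (e : X 1) : target (f 1 e) = f 0 (target e).
Proof. by rewrite /target smap_act. Qed.

(* The degeneracy 0, 1, 2 |-> 0, 0, 1 *)
Lemma odeg_subproof (i j : 'I_3) : i <= j -> (inord i.-1 : 'I_2) <= (inord j.-1 : 'I_2).
Proof.
by case: i j => [[|[|[|?]]] ?] [[|[|[|?]]] ?] //=; rewrite !inordK.
Qed.

Definition odeg : omap 2 1 := @mk_omap 2 1 (fun i => inord i.-1) odeg_subproof.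

Lemma odeg_vertex (j : 'I_2) : ocomp odeg (ocomp (ojoinr 0 1) (ocst 0 j)) = ocst 0 j.
Proof.
apply: omapP => i; rewrite !ocompE !mk_omapE; apply: val_inj => /=.
by rewrite inordK //= ltn_ord.
Qed.

Lemma odeg_ojoinr : ocomp odeg (ojoinr 0 1) = oid 1.
Proof.
apply: omapP => i; rewrite !ocompE !mk_omapE; apply: val_inj => /=.
by rewrite inordK //= ltn_ord.
Qed.

Lemma odeg_ojoinl : ocomp odeg (ojoinl 0 1) = ocst 0 ord0.
Proof.
apply: omapP => i; rewrite !ocompE !mk_omapE; apply: val_inj => /=.
by rewrite [i]ord1 inordK.
Qed.

Lemma slice_id_subproof (C : scaled) (x : C 0) (e : C 1) :
  source e = x -> slice_subc x e 0 (act odeg e : dec 1 C 0).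
Proof.
move=> hs; split=> [||i].
- by rewrite -[LHS]act_comp odeg_ojoinl cst0.
- by rewrite -[LHS]act_comp odeg_ojoinr act_id.
- by rewrite -[act _ (act _ _)]act_comp; exact: thin_degen.
Qed.

(* The degenerate triangle on e : x -> y, viewed as an object of [slice x e]; the
   two legs of the zig-zag send it to the identity of x and to e. *)
Definition slice_id (C : scaled) (x : C 0) (e : C 1) (hs : source e = x) :
    slice x e 0 :=
  exist (slice_subc x e 0) (act odeg e : dec 1 C 0) (slice_id_subproof hs).

Lemma slice_target_id (C : scaled) (x y : C 0) (e : C 1) (hs : source e = x)
    (ht : target e = y) :
  slice_target x ht 0 (slice_id hs) = hom_vertex hs ht.
Proof.
apply: eq_exist => /=; rewrite -[LHS]act_comp -[RHS]act_id; congr act.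
apply: (@ojoin_ext 0 0) => i; rewrite ocompE ?ojoin_vertex_l ?ojoin_vertex_r;
  rewrite !mk_omapE; apply: val_inj; by rewrite /= [i]ord1 inordK.
Qed.

Lemma fiber_map_subproof X Y X' Y' (g : smap X Y) (g' : smap X' Y') (p : smap X X')
    (r : smap Y Y') (v : Y 0) (v' : Y' 0)
    (hc : forall n (s : X n), g' n (p n s) = r n (g n s)) (hv : r 0 v = v') n (s : X n) :
  preim g (point v) n s -> preim g' (point v') n (p n s).
Proof. by move=> /= h; rewrite hc h smap_cst hv. Qed.

(* The map induced on fibers by a commutative square *)
Definition fiber_map X Y X' Y' (g : smap X Y) (g' : smap X' Y') (p : smap X X')
    (r : smap Y Y') (v : Y 0) (v' : Y' 0)
    (hc : forall n (s : X n), g' n (p n s) = r n (g n s)) (hv : r 0 v = v') :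
    smap (fiber g v) (fiber g' v') :=
  sub_map (fiber_map_subproof hc hv).

(* Let e : x' -> y with f x' = f x. The zig-zag hom x x' <- slice x e -> hom x y
   of E lies over the corresponding zig-zag of B for f e; we take its fibers over
   the identity of f x, the degenerate triangle on f e, and f e respectively. The
   first of these fibers is Hom(x, x') computed in the fiber of f over f x. *)

Section Postcomposition.

Context (E B : scaled) (f : scmap E B) (x x' y : E 0) (e : E 1).
Context (hs : source e = x') (ht : target e = y) (hx : f 0 x' = f 0 x).

Lemma postcomp_source : source (f 1 e) = f 0 x.
Proof. by rewrite source_smap hs hx. Qed.

Lemma postcomp_target : target (f 1 e) = f 0 y.
Proof. by rewrite target_smap ht. Qed.

(* The fiber of [hom_map f x y] over f e *)
Definition hom_fiber : sset :=
  fiber (hom_map f x y) (hom_vertex postcomp_source postcomp_target).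

(* Hom(x, x') in the fiber of f over f x *)
Definition fiber_hom : marked_sset :=
  @hom (scaled_fiber f (f 0 x)) (fiber_vertex (f := f) erefl) (fiber_vertex (f := f) hx).

Definition slice_fiber : sset := fiber (slice_map f x e) (slice_id postcomp_source).

Lemma slice_fiber_source n (s : slice_fiber n) :
  preim f (point (f 0 x)) (n + 1) (sval (slice_source x hs n (sval s))).
Proof.
case: s => s /= /(congr1 sval) /= h; rewrite smap_act h.
rewrite -postcomp_source /source /cst -!act_comp; congr act.
apply: (@ojoin_ext n 0) => i; rewrite !ocompE ?ojoin_vertex_l ?ojoin_vertex_r.
  rewrite ojoin_l !mk_omapE; apply: val_inj; by rewrite /= inordK.
by rewrite ojoin_r !mk_omapE; apply: val_inj; rewrite /= inordK.
Qed.

Definition postcomp_left_fun n (s : slice_fiber n) :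
    dec 0 (scaled_fiber f (f 0 x)) n :=
  exist (preim f (point (f 0 x)) (n + 1)) (sval (slice_source x hs n (sval s)))
    (slice_fiber_source s).

Lemma postcomp_left_hom n (s : slice_fiber n) :
  hom_subc (fiber_vertex (f := f) erefl : scaled_fiber f (f 0 x) 0)
    (fiber_vertex (f := f) hx) n (postcomp_left_fun s).
Proof.
have [hl hr] := proj2_sig (slice_source x hs n (sval s)).
by split; apply: eq_exist.
Qed.

Lemma postcomp_left_act m n (a : omap m n) (s : slice_fiber n) :
  exist (hom_subc _ _ m) (postcomp_left_fun (act a s)) (postcomp_left_hom (act a s)) =
  act a (exist (hom_subc _ _ n) (postcomp_left_fun s) (postcomp_left_hom s)
         : fiber_hom n).
Proof.
apply: eq_exist; apply: eq_exist => /=.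
exact: (smap_act (dec_vertex E ord0) a (sval (sval s))).
Qed.

Definition postcomp_left : smap slice_fiber fiber_hom :=
  @SMap slice_fiber fiber_hom
    (fun n s => exist (hom_subc _ _ n) (postcomp_left_fun s) (postcomp_left_hom s))
    postcomp_left_act.

Lemma postcomp_right_subproof n (s : slice x e n) :
  hom_map f x y n (slice_target x ht n s) =
  slice_target (f 0 x) postcomp_target n (slice_map f x e n s).
Proof. by apply: eq_exist => /=; rewrite smap_act. Qed.

Definition postcomp_right : smap slice_fiber hom_fiber :=
  fiber_map postcomp_right_subproof
    (slice_target_id postcomp_source postcomp_target).

End Postcomposition.

(* Main.v *)
Require Import Defs.
From mathcomp Require Import all_boot.
From mathcomp Require Import boolp classical_sets.
From Stdlib Require Import Relations.
(* Let omap denote monotone maps again, not the functorial action of option. *)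
Import Defs.

Set Implicit Arguments.
Unset Strict Implicit.
Unset Printing Implicit Defensive.

Local Open Scope classical_set_scope.

(** Write [n] * [k] for the join of ordinals, so that an n-simplex of a mapping
    category is an (n+1)-simplex of the ambient object, of shape [n] * [0], which is
    constant at x on [n].

    Left and right fibrations. A horn Lambda^n_i in Hom(x, y), together with the
    constant face on [n], is the same thing as a horn Lambda^(n+1)_i in E whose face
    opposite to the last vertex is constant at x (hom_horn_filler). If i = 0, its edge
    {0, 1} is degenerate, so it is filled by the lifting property of outer fibrations
    against collapsed horns. If 0 < i < n, its triangle {i-1, i, i+1} is degenerate,
    hence thin, so it is filled by any weak fibration. If 0 < i <= n, it is an inner
    horn, so it is filled by any inner fibration.

    Post-composition. Both legs of the zig-zag of fibers turn out to be trivial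
    Kan fibrations. An n-simplex of the middle term is an (n+2)-simplex of E over a fixed
    degenerate simplex of B. When its boundary is known, together with its image under one
    of the legs, it is known on all of the faces of Delta^(n+2) except one
    (slice_fiber_filler). For the leg towards Hom(x, x') the missing face is opposite
    to n+1, and the inner horn is filled by a weak fibration. For the leg towards
    Hom(x, y) it is opposite to n+2; the last edge of the horn is e, and the filler exists
    because e is cartesian. All triangles that have to be thin lie over degenerate
    triangles of B, and f detects thin triangles.

    A trivial fibration is a homotopy equivalence: it has a section, and the section
    is a homotopy inverse, because partial lifts extend along inclusions
    (trivial_fibration_extend). If both legs of a zig-zag are trivial fibrations, the
    map it represents is the second leg after a section of the first. *)

(** * Simplicial maps and monotone maps *)

(** All gluing constructions below describe a map by its graph, so that no choice of
    a factorisation has to be made coherently. *)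
Lemma rel_smap (X Y : sset) (R : forall n, X n -> Y n -> Prop) :
    (forall m n (a : omap m n) s y, R n s y -> R m (act a s) (act a y)) ->
    (forall n s, exists y, R n s y) ->
    (forall n s y y', R n s y -> R n s y' -> y = y') ->
  exists u : smap X Y, forall n s, R n s (u n s).
Proof.
move=> Ract Rtot Rfun.
pose u n s := sval (cid (Rtot n s)).
have Ru n s : R n s (u n s) by rewrite /u; case: cid.
have uact m n (a : omap m n) (s : X n) : u m (act a s) = act a (u n s).
  by apply: Rfun (Ru _ _) _; apply: Ract.
by exists (SMap uact).
Qed.

Lemma smapP (X Y : sset) (u v : smap X Y) : (forall n s, u n s = v n s) -> u = v.
Proof.
case: u v => [u hu] [v hv] /= uv.
have {}uv : u = v by apply: functional_extensionality_dep => n; apply: funext.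
by case: v / uv hv => hv; congr SMap; apply: Prop_irrelevance.
Qed.

Lemma sub_inj (X : sset) (A : subc X) n (s s' : sub A n) : sval s = sval s' -> s = s'.
Proof. by case: s s' => [s h] [s' h'] /= e; apply: eq_exist. Qed.

Lemma simp_map_subproof (X : sset) n (x : X n) m p (a : omap m p) (d : simp n p) :
  act (act a d : simp n m) x = act a (act d x).
Proof. by rewrite /= act_comp. Qed.

Definition simp_map (X : sset) n (x : X n) : smap (simp n) X :=
  @SMap (simp n) X (fun m d => act d x) (simp_map_subproof x).

Lemma ocompA m n p q (h : omap p q) (g : omap n p) (f : omap m n) :
  ocomp h (ocomp g f) = ocomp (ocomp h g) f.
Proof. by apply: omapP => i; rewrite !ocompE. Qed.

Lemma ocomp_id m n (f : omap m n) : ocomp (oid n) f = f.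
Proof. by apply: omapP => i; rewrite ocompE mk_omapE. Qed.

Lemma omap_le_inj m n (g : omap m n) (i j : 'I_m.+1) :
  injective g -> g i <= g j -> i <= j.
Proof.
move=> gI; case: (leqP i j) => // ji le_g.
have /eqP/val_inj/gI e : (g i : nat) == g j by rewrite eqn_leq le_g omap_le // ltnW.
by rewrite e ltnn in ji.
Qed.

Lemma ocomp_inj m n p (g : omap n p) (d d' : omap m n) :
  injective g -> ocomp g d = ocomp g d' -> d = d'.
Proof.
by move=> gI e; apply: omapP => i; apply: gI; rewrite -!ocompE e.
Qed.

Lemma omap_factor m n p (g : omap n p) (d : omap m p) :
    injective g -> (forall i, exists k, d i = g k) ->
  exists d', d = ocomp g d'.
Proof.
move=> gI /choice[r hr].
have r_le (i j : 'I_m.+1) : i <= j -> r i <= r j.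
  by move=> ij; apply: (omap_le_inj gI); rewrite -!hr omap_le.
by exists (mk_omap r_le); apply: omapP => i; rewrite ocompE mk_omapE.
Qed.

Lemma omap_section_le m n (s : omap m n) (r : 'I_n.+1 -> 'I_m.+1) :
  cancel r s -> forall i j : 'I_n.+1, i <= j -> r i <= r j.
Proof.
move=> rK i j; rewrite leq_eqVlt => /orP[/eqP/val_inj -> //|]; apply: contraTT.
by rewrite -!ltnNge => /ltnW /(omap_le s); rewrite !rK.
Qed.

(** Sections of a surjection of ordinals can be prescribed at one point. This is what
    makes a surjection determined by its sections, in extend_partial_lift. *)
Lemma omap_section m n (s : omap m n) (i0 : 'I_m.+1) :
    (forall k, exists i, s i = k) ->
  exists2 r : omap n m, ocomp s r = oid n & r (s i0) = i0.
Proof.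
move=> /choice[r0 r0K].
pose r k := if k == s i0 then i0 else r0 k.
have rK : cancel r s by move=> k; rewrite /r; case: eqP.
exists (mk_omap (omap_section_le rK)); last by rewrite mk_omapE /r eqxx.
by apply: omapP => k; rewrite ocompE !mk_omapE rK.
Qed.

(** Both f and its inverse g are strictly increasing, so that i <= f i and i <= g i for
    all i; the latter at f i gives f i <= i. *)
Lemma inj_omap_id n (f : omap n n) : injective f -> f = oid n.
Proof.
move=> fI.
have ge_id (g : omap n n) : injective g -> forall i : 'I_n.+1, i <= g i.
  move=> gI [i]; elim: i => //= i IH lt_i.
  have lt_i' := ltnW lt_i.
  apply: leq_ltn_trans (IH lt_i') _.
  by rewrite ltnNge; apply/negP => /(omap_le_inj gI); rewrite ltnn.
have [g fK gK] := injF_bij fI.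
have gI : injective g by apply: can_inj gK.
have gle := omap_section_le gK.
apply: omapP => i; rewrite mk_omapE; apply/val_inj/eqP; rewrite eqn_leq ge_id // andbT.
have := ge_id (mk_omap gle).
move=> /(_ _ (f i)); rewrite mk_omapE fK; apply.
by move=> j k; rewrite !mk_omapE; apply: gI.
Qed.

Lemma oidE n i : oid n i = i.
Proof. exact: mk_omapE. Qed.

Lemma surj_omap_id n (f : omap n n) : (forall k, exists i, f i = k) -> f = oid n.
Proof.
move=> fS; have [r fr _] := omap_section ord0 fS.
have rI : injective r.
  by move=> i j e; rewrite -[i]oidE -[j]oidE -fr !ocompE e.
by rewrite -[LHS]simp_act_id -{1}(inj_omap_id rI) fr.
Qed.

(** * Trivial fibrations *)

Lemma boundary_subproof n m p (a : omap m p) (s : simp n p) :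
  (exists j : 'I_n.+1, forall k, s k != j) ->
  exists j : 'I_n.+1, forall k, @act (simp n) m p a s k != j.
Proof. by case=> j hj; exists j => k; rewrite ocompE. Qed.

Definition boundary n : subc (simp n) :=
  @SubC (simp n)
    (fun m => [set s : omap m n | exists j : 'I_n.+1, forall k, s k != j])
    (@boundary_subproof n).

(** Lifting against the inclusion of the boundary of Delta^n, with a map out of Delta^n
    replaced by the simplex that represents it. *)
Definition trivial_fibration (Z A : sset) (p : smap Z A) : Prop :=
  forall n (w : smap (sub (boundary n)) Z) (a : A n),
    (forall m (c : sub (boundary n) m), p m (w m c) = act (sval c) a) ->
  exists2 z : Z n, p n z = a & forall m (c : sub (boundary n) m), act (sval c) z = w m c.

Lemma boundary_surj n m (s : simp n m) : ~ boundary n m s -> forall k, exists i, s i = k.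
Proof.
move=> nb k; apply: contrapT => nk; apply: nb; exists k => i.
by apply/eqP => e; apply: nk; exists i.
Qed.

Lemma boundary_factor n m (c : simp n.+1 m) : boundary n.+1 m c ->
  exists (g : omap n n.+1) (d : omap m n), c = ocomp g d.
Proof.
case=> j cj.
have g_le (a b : 'I_n.+1) : a <= b -> lift j a <= lift j b.
  by move=> ab; rewrite /= leq_bump2.
exists (mk_omap g_le).
apply: omap_factor => [a b|i]; first by rewrite !mk_omapE; apply: lift_inj.
have ji : j != c i by rewrite eq_sym.
by have [k e _] := unlift_some ji; exists k; rewrite mk_omapE.
Qed.

Section Extension.

Context (Z A X : sset) (p : smap Z A) (q : smap X A).

Local Notation graph := (set {n : nat & (X n * Z n)%type}).
Local Notation pt s z := (existT (fun n : nat => (X n * Z n)%type) _ (s, z)).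

(** The graph of a lift of q along p over a subcomplex of X. Graphs are used because the
    union of a chain of them is again one. *)
Definition partial_lift (G : graph) : Prop :=
  [/\ forall n (s : X n) (z : Z n), G (pt s z) -> p n z = q n s,
      forall m n (a : omap m n) (s : X n) (z : Z n),
        G (pt s z) -> G (pt (act a s) (act a z))
    & forall n (s : X n) (z z' : Z n), G (pt s z) -> G (pt s z') -> z = z'].

(** The condition given to Zorn's lemma speaks of the union of G0 and G, since the empty
    chain has the empty union, which need not contain G0. *)
Lemma max_partial_lift (G0 : graph) : partial_lift G0 ->
  exists2 G, partial_lift G /\ G0 `<=` G &
    forall G', partial_lift G' -> G `<=` G' -> G' `<=` G.
Proof.
move=> G0P.
have chain (F : set graph) : F `<=` (fun G => partial_lift (G0 `|` G)) ->
    total_on F subset -> partial_lift (G0 `|` \bigcup_(G in F) G).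
  move=> FP Ftot; split.
  - move=> n s z [h|[G FG h]]; first by case: G0P => hp _ _; apply: hp.
    by have [hp _ _] := FP _ FG; apply: hp; right.
  - move=> m n a s z [h|[G FG h]]; first by left; case: G0P => _ ha _; apply: ha.
    have [_ ha _] := FP _ FG; have [|h'] := ha _ _ a s z (or_intror h); first by left.
    by right; exists G.
  - have two n (s : X n) (z z' : Z n) G : F G ->
        (G0 `|` G) (pt s z) -> (G0 `|` G) (pt s z') -> z = z'.
      by move=> FG; have [_ _ hf] := FP _ FG; apply: hf.
    move=> n s z z' [h|[G FG h]] [h'|[G' FG' h']].
    + by case: G0P => _ _ hf; apply: hf h h'.
    + by apply: two FG' (or_introl h) (or_intror h').
    + by apply: two FG (or_intror h) (or_introl h').
    + case: (Ftot _ _ FG FG') => le.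
        by apply: two FG' (or_intror (le _ h)) (or_intror h').
      by apply: two FG (or_intror h) (or_intror (le _ h')).
have [G [GP Gmax]] := Zorn_bigcup chain.
exists (G0 `|` G); first by split=> // x; left.
move=> G' G'P le; apply: contrapT => nle; apply: (Gmax G').
  by split=> [x Gx|le']; [apply: le; right | apply: nle => x /le'; right].
by have -> : G0 `|` G' = G' by apply/setUidPr => x G0x; apply: le; left.
Qed.

(** If s is not yet in the domain but everything below its dimension is, then s is
    nondegenerate with boundary in the domain. Fill the boundary by z and send act a s
    to act a z. This is well defined by the Eilenberg-Zilber argument: if a is not
    surjective the value is already prescribed, and two surjections a, a' with
    act a s = act a' s coincide, since a' r is the identity for every section r of a,
    as otherwise s would be a simplex act d s with d not surjective. *)
Lemma extend_partial_lift (G : graph) n (s : X n) : trivial_fibration p ->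
    partial_lift G ->
    (forall m (a : omap m n), m < n -> exists z, G (pt (act a s) z)) ->
  exists G', [/\ partial_lift G', G `<=` G' & exists z, G' (pt s z)].
Proof.
move=> pT GP hs; have [Gp Ga Gf] := GP.
have [[z Gz]|ns] := pselect (exists z, G (pt s z)); first by exists G; split=> //; exists z.
have bd m (c : sub (boundary n) m) : exists z, G (pt (act (sval c) s) z).
  case: c => c /=; case: n s hs ns c => [|n] s hs ns c hc.
    by case: hc => j /(_ ord0); rewrite [j]ord1 [c ord0]ord1 eqxx.
  have [g [d ->]] := boundary_factor hc.
  have [z Gz] := hs _ g (ltnSn _).
  by exists (act d z); rewrite act_comp; apply: Ga.
have [w Gw] : exists w : smap (sub (boundary n)) Z,
    forall m (c : sub (boundary n) m), G (pt (act (sval c) s) (w m c)).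
  apply: (@rel_smap (sub (boundary n)) Z (fun m c z => G (pt (act (sval c) s) z))) => //.
    by move=> m l a c z /=; rewrite act_comp; apply: Ga.
  by move=> m c z z'; apply: Gf.
have [z pz zw] := pT n w (q n s) (fun m c => etrans (Gp _ _ _ (Gw m c)) (smap_act _ _ _)).
(* The new values: z, and what it forces by naturality. *)
pose N : graph := [set x | exists m (a : omap m n), x = pt (act a s) (act a z)].
have bdP m (a : omap m n) z' : G (pt (act a s) z') -> boundary n m a.
  move=> Gz'; apply: contrapT => /boundary_surj sur.
  have [r ar _] := omap_section ord0 sur.
  by apply: ns; exists (act r z'); rewrite -[s]act_id -ar act_comp; apply: Ga.
have ns_bd (d : omap n n) : act d s = s -> d = oid n.
  move=> ds; apply: surj_omap_id; apply: boundary_surj => hd.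
  by have [z' Gz'] := bd _ (exist _ d hd); apply: ns; exists z'; rewrite -ds.
have bdE m (a : omap m n) z' : G (pt (act a s) z') -> z' = act a z.
  move=> Gz'; have ha := bdP _ _ _ Gz'; rewrite (zw _ (exist _ a ha)).
  by apply: Gf Gz' (Gw _ (exist _ a ha)).
have NE m (a a' : omap m n) : act a s = act a' s -> act a z = act a' z.
  move=> aa'; have [ha|na] := pselect (boundary n m a).
    by rewrite (zw _ (exist _ a ha)); apply: bdE; rewrite -aa'; apply: (Gw _ (exist _ a ha)).
  congr act; apply: omapP => i.
  have [r ar ri] := omap_section i (boundary_surj na).
  have := ns_bd (ocomp a' r); rewrite act_comp -aa' -act_comp ar act_id => /(_ erefl) a'r.
  by rewrite -{2}ri -ocompE a'r oidE.
have inN m (s' : X m) z' : N (pt s' z') -> exists2 a : omap m n, s' = act a s & z' = act a z.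
  case=> l [a e]; have el := projT1_eq e; rewrite /= in el; case: l / el a e => a e.
  by have := existT_inj2 e; case=> -> ->; exists a.
exists (G `|` N); split=> [|x|]; [split | by left |].
- move=> m s' z' [/Gp //|/inN[a -> ->]]; by rewrite !smap_act pz.
- move=> m l b s' z' [h|/inN[a -> ->]]; first by left; apply: Ga.
  by right; exists m, (ocomp a b); rewrite !act_comp.
- move=> m s' z1 z2 [h1|/inN[a1 -> ->]] [h2|/inN[a2 e2 ->]].
  + exact: Gf h1 h2.
  + by apply: bdE; rewrite -e2.
  + by apply/esym/bdE.
  + exact: NE.
- by exists z; right; exists n, (oid n); rewrite !act_id.
Qed.

Lemma trivial_fibration_extend (G0 : graph) : trivial_fibration p -> partial_lift G0 ->
  exists h : smap X Z, (forall n s, p n (h n s) = q n s) /\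
    forall n (s : X n) (z : Z n), G0 (pt s z) -> h n s = z.
Proof.
move=> pT /max_partial_lift[G [GP G0G] Gmax].
have [Gp Ga Gf] := GP.
have tot n (s : X n) : exists z, G (pt s z).
  elim/ltn_ind: n s => n IH s.
  have [G' [G'P GG' [z G'z]]] := extend_partial_lift pT GP (fun m a lt => IH m lt (act a s)).
  by exists z; apply: Gmax G'z.
have [h Gh] := @rel_smap X Z (fun n s z => G (pt s z)) Ga tot Gf.
exists h; split=> [n s|n s z /G0G Gz]; first exact: Gp.
exact: Gf (Gh n s) Gz.
Qed.

End Extension.

(** * Homotopy equivalences *)

Lemma eq_homotopic (A B : sset) (f g : smap A B) :
  (forall n s, f n s = g n s) -> homotopic f g.
Proof. by move=> /smapP ->; apply: rst_refl. Qed.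

Lemma homotopic_whiskerl (A B C : sset) (k : smap B C) (f g : smap A B) :
  homotopic f g -> homotopic (scomp k f) (scomp k g).
Proof.
elim=> {f g} [f g [H [H0 H1]]|f|f g _|f g h _ fg _ gh].
- by apply: rst_step; exists (scomp k H); split=> n a /=; rewrite ?H0 ?H1.
- exact: rst_refl.
- exact: rst_sym.
- exact: rst_trans fg gh.
Qed.

Lemma homotopic_whiskerr (A B C : sset) (k : smap A B) (f g : smap B C) :
  homotopic f g -> homotopic (scomp f k) (scomp g k).
Proof.
have act_k m n (a : omap m n) (x : sprod A (simp 1) n) :
    (k m (act a x).1, (act a x).2) = @act (sprod B (simp 1)) _ _ a (k n x.1, x.2).
  by rewrite /= smap_act.
elim=> {f g} [f g [H [H0 H1]]|f|f g _|f g h _ fg _ gh].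
- apply: rst_step; exists (scomp H (@SMap (sprod A (simp 1)) (sprod B (simp 1)) _ act_k)).
  by split=> n a /=; rewrite ?H0 ?H1.
- exact: rst_refl.
- exact: rst_sym.
- exact: rst_trans fg gh.
Qed.

Lemma homotopy_equivalence_comp (A B C : sset) (f : smap A B) (g : smap B C) :
  homotopy_equivalence f -> homotopy_equivalence g -> homotopy_equivalence (scomp g f).
Proof.
move=> [f' [f'f ff']] [g' [g'g gg']]; exists (scomp f' g'); split.
- apply: rst_trans f'f.
  have /(homotopic_whiskerl f')/(homotopic_whiskerr f) h := g'g.
  apply: rst_trans (eq_homotopic _) (rst_trans _ _ _ _ _ h (eq_homotopic _)) => //.
- apply: rst_trans gg'.
  have /(homotopic_whiskerl g)/(homotopic_whiskerr g') h := ff'.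
  apply: rst_trans (eq_homotopic _) (rst_trans _ _ _ _ _ h (eq_homotopic _)) => //.
Qed.

(** The section is a lift of the identity of A; the homotopy is a lift of p pr1 on
    Z x Delta^1, prescribed at both ends. *)
Lemma trivial_fibration_section (Z A : sset) (p : smap Z A) : trivial_fibration p ->
  exists s : smap A Z, (forall n a, p n (s n a) = a) /\
    elem_homotopic (scomp s p) (sid Z).
Proof.
move=> pT.
have [s [ps _]] : exists s : smap A Z, (forall n a, p n (s n a) = sid A n a) /\
    (forall n (a : A n) (z : Z n), set0 (existT (fun n => (A n * Z n)%type) n (a, z)) ->
       s n a = z).
  by apply: trivial_fibration_extend => //; split.
exists s; split=> //.
pose X := sprod Z (simp 1).
pose pr := @SMap X Z (fun _ x => x.1) (fun _ _ _ _ => erefl).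
pose G0 : set {n : nat & (X n * Z n)%type} := fun x =>
  (tagged x).1.2 = ocst _ ord0 /\ (tagged x).2 = s _ (p _ (tagged x).1.1) \/
  (tagged x).1.2 = ocst _ ord_max /\ (tagged x).2 = (tagged x).1.1.
have ocst_neq n : ocst n (ord0 : 'I_2) <> ocst n ord_max.
  by move=> /(congr1 (fun c : omap n 1 => val (c ord0))); rewrite !mk_omapE.
have ocst_act m n k (a : omap m n) (i : 'I_k.+1) : ocomp (ocst n i) a = ocst m i.
  by apply: omapP => j; rewrite ocompE !mk_omapE.
have G0P : partial_lift p (scomp p pr) G0.
  split.
  - by move=> n [u t] z [] [/= _ ->]; rewrite ?ps.
  - move=> m n a [u t] z [] [/= -> ->]; [left|right]; split=> //=; try exact: ocst_act.
    by rewrite !smap_act.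
  - by move=> n [u t] z z' [] [/= -> ->] [] [/= h ->] //; have := ocst_neq n; rewrite h.
have [H [_ HG]] := trivial_fibration_extend pT G0P.
by exists H; split=> n a; apply: HG; [left|right].
Qed.

Lemma trivial_fibration_equivalence (Z A : sset) (p : smap Z A) :
  trivial_fibration p -> homotopy_equivalence p.
Proof.
move=> /trivial_fibration_section[s [ps sp]]; exists s; split; first exact: rst_step.
exact: eq_homotopic.
Qed.

Lemma zigzag_trivial_fibrations (A Z B : sset) (p : smap Z A) (q : smap Z B) :
  trivial_fibration p -> trivial_fibration q -> zigzag_equivalence p q.
Proof.
move=> pT qT; have pE := trivial_fibration_equivalence pT; split=> //.
have [s [ps sp]] := trivial_fibration_section pT.
exists (scomp q s); split.
  have /(homotopic_whiskerl q) h : homotopic (scomp s p) (sid Z) by apply: rst_step.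
  apply: rst_trans (eq_homotopic _) (rst_trans _ _ _ _ _ h (eq_homotopic _)) => //.
apply: homotopy_equivalence_comp (trivial_fibration_equivalence qT).
by exists p; split; [apply: eq_homotopic | apply: rst_step].
Qed.

(** * Maps into a join of ordinals *)

Lemma ojoinl_inj n k : injective (ojoinl n k).
Proof. by move=> i j; rewrite !ojoinlE; apply: (@lshift_inj n.+1 k.+1). Qed.

Lemma ojoinr_inj n k : injective (ojoinr n k).
Proof. by move=> i j; rewrite !ojoinrE; apply: (@rshift_inj n.+1 k.+1). Qed.

Lemma split_ojoinl n k (i : 'I_n.+1) : split (ojoinl n k i : 'I_(n.+1 + k.+1)) = inl i.
Proof. by rewrite ojoinlE -[lshift _ _]/(unsplit (inl i)) unsplitK. Qed.

Lemma split_ojoinr n k (i : 'I_k.+1) : split (ojoinr n k i : 'I_(n.+1 + k.+1)) = inr i.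
Proof. by rewrite ojoinrE -[rshift _ _]/(unsplit (inr i)) unsplitK. Qed.

Lemma ojoin_ojoinlE k m n (c : omap m n) i : ojoin k c (ojoinl m k i) = ojoinl n k (c i).
Proof. by rewrite !ojoinlE ojoin_l. Qed.

Lemma ojoin_ojoinrE k m n (c : omap m n) i : ojoin k c (ojoinr m k i) = ojoinr n k i.
Proof. by rewrite !ojoinrE ojoin_r. Qed.

Lemma ojoin_left_case n k (x : 'I_(n + k.+1).+1) :
  (exists2 i : 'I_n.+1, x = ojoinl n k i & x <= n) \/
  (exists2 i : 'I_k.+1, x = ojoinr n k i & n < x).
Proof.
rewrite -(splitK (x : 'I_(n.+1 + k.+1))); case: (split _) => i /=.
  by left; exists i; rewrite ?ojoinlE //= -ltnS.
by right; exists i; rewrite ?ojoinrE //= ltn_addr.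
Qed.

Lemma ojoinl_le n k i : ojoinl n k i <= n.
Proof. by rewrite ojoinlE /= leq_ord. Qed.

Lemma ojoinr_gt n k i : n < ojoinr n k i.
Proof. by rewrite ojoinrE /= ltn_addr. Qed.

Lemma ojoinl_neq_ojoinr n k i j : ojoinl n k i != ojoinr n k j.
Proof. by apply/eqP => e; have := ojoinr_gt n j; rewrite -e ltnNge ojoinl_le. Qed.

Lemma ojoinl_factor n k m (d : omap m (n + k.+1)) :
  (forall i, d i <= n) -> exists d' : omap m n, d = ocomp (ojoinl n k) d'.
Proof.
move=> dn; apply: omap_factor => [|i]; first exact: ojoinl_inj.
case: (ojoin_left_case (d i)) => [[a e _]|[a _]]; first by exists a.
by rewrite ltnNge dn.
Qed.

Lemma ojoinr_factor n k m (d : omap m (n + k.+1)) :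
  (forall i, n < d i) -> exists d' : omap m k, d = ocomp (ojoinr n k) d'.
Proof.
move=> dn; apply: omap_factor => [|i]; first exact: ojoinr_inj.
case: (ojoin_left_case (d i)) => [[a _]|[a e _]]; last by exists a.
by rewrite leqNgt dn.
Qed.

Lemma ojoin_le k m n (c : omap m n) x : (ojoin k c x <= n) = (x <= m).
Proof.
case: (ojoin_left_case x) => [[i -> _]|[i -> _]].
  by rewrite ojoin_ojoinlE !ojoinl_le.
by rewrite ojoin_ojoinrE [LHS]leqNgt [RHS]leqNgt !ojoinr_gt.
Qed.

(** A map d : [m] -> [n] * [k] whose last value in [n] is taken at i0 factors as
    [m] -> [m] * [k] -> [n] * [k], where the second map is b * id for some
    b : [m] -> [n], and the first one, the shape of d, is unchanged when d is composed
    with a map c * id. The part of [m] that d sends to [k] has to go somewhere under b;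
    it is sent to d i0, so that b has no values in [n] other than those of d. *)
Section JoinShape.

Context (n k m : nat) (d : omap m (n + k.+1)).

Definition left_part_fun (i0 i : 'I_m.+1) : 'I_n.+1 :=
  match split (d (if i <= i0 then i else i0) : 'I_(n.+1 + k.+1)) with
  | inl a => a
  | inr _ => ord_max
  end.

Lemma left_part_subproof (i0 i j : 'I_m.+1) :
  i <= j -> left_part_fun i0 i <= left_part_fun i0 j.
Proof.
move=> ij; rewrite /left_part_fun.
set i' := (if i <= i0 then i else i0); set j' := (if j <= i0 then j else i0).
have : i' <= j'.
  rewrite /i' /j'; case: ifP => ii0; case: ifP => // ji0.
  by rewrite (leq_trans ij ji0) in ii0.
move=> ij'; have := omap_le d ij'; case: splitP => a ->; case: splitP => b -> //.
- by move=> _; apply: leq_ord.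
- by move=> h; have := ltn_ord b; rewrite ltnNge (leq_trans (leq_addr _ _) h).
Qed.

Definition left_part i0 : omap m n := mk_omap (@left_part_subproof i0).

Definition shape_fun (i : 'I_m.+1) : 'I_(m.+1 + k.+1) :=
  match split (d i : 'I_(n.+1 + k.+1)) with
  | inl _ => lshift k.+1 i
  | inr j => rshift m.+1 j
  end.

Lemma shape_subproof (i j : 'I_m.+1) : i <= j -> shape_fun i <= shape_fun j.
Proof.
move=> ij; have := omap_le d ij; rewrite /shape_fun.
case: splitP => a ->; case: splitP => b -> //.
- by move=> _; apply: leq_trans (ltnW (ltn_ord i)) (leq_addr _ _).
- by move=> h; have := ltn_ord b; rewrite ltnNge (leq_trans (leq_addr _ _) h).
- by rewrite /= !leq_add2l.
Qed.

Definition shape : omap m (m + k.+1) := @mk_omap m (m + k.+1) shape_fun shape_subproof.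

End JoinShape.

Lemma left_part_ojoin n k m l (c : omap l n) (d : omap m (l + k.+1)) (i0 : 'I_m.+1) :
  d i0 <= l -> left_part (ocomp (ojoin k c) d) i0 = ocomp c (left_part d i0).
Proof.
move=> di0; apply: omapP => i; rewrite ocompE !mk_omapE /left_part_fun ocompE.
set j := if _ then _ else _.
have : d j <= l by rewrite /j; case: ifP => // ii0; apply: leq_trans (omap_le d ii0) di0.
case: (ojoin_left_case (d j)) => [[a -> _] _|[a _]]; last by rewrite ltnNge => /negP.
by rewrite ojoin_ojoinlE !split_ojoinl.
Qed.

Lemma shape_ojoin n k m l (c : omap l n) (d : omap m (l + k.+1)) :
  shape (ocomp (ojoin k c) d) = shape d.
Proof.
apply: omapP => i; rewrite !mk_omapE /shape_fun ocompE.
case: (ojoin_left_case (d i)) => [[a -> _]|[a -> _]].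
  by rewrite ojoin_ojoinlE !split_ojoinl.
by rewrite ojoin_ojoinrE !split_ojoinr.
Qed.

Lemma ojoin_left_shape n k m (d : omap m (n + k.+1)) (i0 : 'I_m.+1) :
  (forall i : 'I_m.+1, (d i <= n) = (i <= i0)) ->
  d = ocomp (ojoin k (left_part d i0)) (shape d).
Proof.
move=> hi0; apply: omapP => i; rewrite ocompE [shape d i]mk_omapE /shape_fun.
have := hi0 i; case: (ojoin_left_case (d i)) => [[a e ->]|[a e _ _]].
  move=> /esym ii0.
  rewrite e split_ojoinl ojoin_l [left_part d i0 i]mk_omapE /left_part_fun ii0.
  by rewrite e split_ojoinl ojoinlE.
by rewrite e split_ojoinr ojoin_r ojoinrE.
Qed.

Lemma last_left n k m (d : omap m (n + k.+1)) :
  (exists d' : omap m k, d = ocomp (ojoinr n k) d') \/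
  (exists i0 : 'I_m.+1, forall i : 'I_m.+1, (d i <= n) = (i <= i0)).
Proof.
have [[i1 hi1]|none] := pselect (exists i : 'I_m.+1, d i <= n); last first.
  left; apply: ojoinr_factor => i; rewrite ltnNge; apply/negP => le.
  by apply: none; exists i.
right; case: (@arg_maxnP _ i1 (fun i => d i <= n) (fun i => i) hi1) => i0 hi0 max_i0.
by exists i0 => i; apply/idP/idP => [/max_i0 //|ii0]; apply: leq_trans (omap_le d ii0) hi0.
Qed.

(** * Gluing maps out of horns in a join *)

(** Let A be a subcomplex of Delta^n and K a subcomplex of the union of A * Delta^k, of the
    second factor Delta^k and of the image of a monomorphism g. A map out of K is glued from a map w : A -> dec k X, a
    simplex e and a simplex t that agree on the intersections. The horns Lambda^(n+1)_i
    and Lambda^(n+2)_i used below are such unions, for A a horn or the boundary of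
    Delta^n and g a face map. The simplex e has a clause of its own because A may be
    empty. *)
Section JoinGlue.

Context (X : sset) (n k : nat) (A : subc (simp n)) (w : smap (sub A) (dec k X)) (e : X k).
Context (p : nat) (g : omap p (n + k.+1)) (t : X p) (K : subc (simp (n + k.+1))).

Inductive join_glue m (d : omap m (n + k.+1)) (z : X m) : Prop :=
| JoinGlueLeft l (c : sub A l) (d' : omap m (l + k.+1)) of
    d = ocomp (ojoin k (sval c)) d' & z = act d' (w l c)
| JoinGlueRight (d' : omap m k) of d = ocomp (ojoinr n k) d' & z = act d' e
| JoinGlueFace (d' : omap m p) of d = ocomp g d' & z = act d' t.

Lemma join_glue_left l (c : sub A l) : join_glue (ojoin k (sval c)) (w l c).
Proof. by apply: (@JoinGlueLeft _ _ _ _ c (oid _)); rewrite ?simp_act_id ?act_id. Qed.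

Lemma join_glue_right : join_glue (ojoinr n k) e.
Proof. by apply: (@JoinGlueRight _ _ _ (oid _)); rewrite ?simp_act_id ?act_id. Qed.

Lemma join_glue_face : join_glue g t.
Proof. by apply: (@JoinGlueFace _ _ _ (oid _)); rewrite ?simp_act_id ?act_id. Qed.

Hypothesis w_right : forall m (c : sub A m), act (ojoinr m k) (w m c) = e.
Hypothesis g_inj : injective g.
Hypothesis g_left : forall m l (c : sub A l) (d1 : omap m (l + k.+1)) (d2 : omap m p),
  ocomp (ojoin k (sval c)) d1 = ocomp g d2 -> act d1 (w l c) = act d2 t.
Hypothesis g_right : forall m (d1 : omap m k) (d2 : omap m p),
  ocomp (ojoinr n k) d1 = ocomp g d2 -> act d1 e = act d2 t.
Hypothesis K_cover : forall m (d : omap m (n + k.+1)), K m d ->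
  (exists d', d = ocomp g d') \/
  exists2 j : 'I_n.+1, forall i, d i != ojoinl n k j &
    forall l (c : omap l n), (forall i, c i != j) -> A l c.

(** If (c1 * id) d1 = (c2 * id) d2 = d, then d1 and d2 have the same shape s, and both
    sides are equal to act s (w b), where b is the part of d in [n]. If d does not meet
    [n], both sides are a restriction of e. *)
Lemma join_glue_left_left m l1 l2 (c1 : sub A l1) (c2 : sub A l2)
    (d1 : omap m (l1 + k.+1)) (d2 : omap m (l2 + k.+1)) :
  ocomp (ojoin k (sval c1)) d1 = ocomp (ojoin k (sval c2)) d2 ->
  act d1 (w l1 c1) = act d2 (w l2 c2).
Proof.
move=> d12.
have shp : shape d1 = shape d2 by rewrite -(shape_ojoin (sval c1)) d12 shape_ojoin.
have le12 i : (d1 i <= l1) = (d2 i <= l2).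
  by rewrite -(ojoin_le (sval c1)) -(ojoin_le (sval c2)) -!ocompE d12.
case: (last_left d1) => [[d1' e1]|[i0 hi0]].
  have /ojoinr_factor[d2' e2] i : l2 < d2 i.
    by rewrite ltnNge -le12 e1 ocompE -ltnNge ojoinr_gt.
  rewrite e1 e2 !act_comp !w_right; congr act.
  by move: d12; rewrite e1 e2 !ocompA !ojoin_ojoinr; apply/ocomp_inj/ojoinr_inj.
have hi0' i : (d2 i <= l2) = (i <= i0) by rewrite -le12 hi0.
rewrite (ojoin_left_shape hi0) (ojoin_left_shape hi0') shp !act_comp.
have left_eq l (c : sub A l) (b : omap m l) : act (ojoin k b) (w l c) = w m (act b c).
  by rewrite smap_act.
have c12 : act (left_part d1 i0) c1 = act (left_part d2 i0) c2.
  by apply: eq_exist => /=; rewrite -!(@left_part_ojoin n k) ?hi0 ?hi0' ?d12.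
by rewrite !left_eq c12.
Qed.

Lemma join_glue_fun m (d : omap m (n + k.+1)) z z' :
  join_glue d z -> join_glue d z' -> z = z'.
Proof.
have left_right l (c : sub A l) (d1 : omap m (l + k.+1)) (d2 : omap m k) :
    ocomp (ojoin k (sval c)) d1 = ocomp (ojoinr n k) d2 -> act d1 (w l c) = act d2 e.
  move=> d12.
  have /ojoinr_factor[d1' e1] i : l < d1 i.
    by rewrite ltnNge -(ojoin_le (sval c)) -ocompE d12 ocompE -ltnNge ojoinr_gt.
  rewrite e1 act_comp w_right; congr act.
  by move: d12; rewrite e1 ocompA ojoin_ojoinr; apply/ocomp_inj/ojoinr_inj.
case=> [l c d1 -> ->|d1 -> ->|d1 -> ->]; case=> [l' c' d2 e2 ->|d2 e2 ->|d2 e2 ->].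
- exact: join_glue_left_left.
- exact: left_right.
- exact: g_left.
- by apply/esym/left_right.
- by congr act; apply: ocomp_inj e2; apply: ojoinr_inj.
- exact: g_right.
- by apply/esym/g_left.
- by apply/esym/g_right.
- by congr act; apply: ocomp_inj e2.
Qed.

Lemma join_glue_act m l (a : omap l m) (d : omap m (n + k.+1)) z :
  join_glue d z -> join_glue (ocomp d a) (act a z).
Proof.
case=> [l' c d' -> ->|d' -> ->|d' -> ->]; rewrite -ocompA -act_comp.
- exact: JoinGlueLeft erefl erefl.
- exact: JoinGlueRight erefl erefl.
- exact: JoinGlueFace erefl erefl.
Qed.

Lemma join_glue_total m (d : omap m (n + k.+1)) : K m d -> exists z, join_glue d z.
Proof.
case/K_cover=> [[d' e']|[j dj jA]]; first by exists (act d' t); exact: JoinGlueFace e' erefl.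
case: (last_left d) => [[d' e']|[i0 hi0]]; first by exists (act d' e); exact: JoinGlueRight e' erefl.
have de := ojoin_left_shape hi0.
have hA : A m (left_part d i0).
  apply: jA => i; rewrite mk_omapE /left_part_fun; set i' := if _ then _ else _.
  have : d i' <= n by rewrite hi0 /i'; case: ifP.
  have := dj i'; case: (ojoin_left_case (d i')) => [[a -> _]|[a _]]; last by rewrite ltnNge => /negP.
  rewrite split_ojoinl => + _.
  by apply: contraNneq => ->.
by exists (act (shape d) (w m (exist _ _ hA))); exact: (JoinGlueLeft (c := exist _ _ hA)) de erefl.
Qed.

Lemma join_glue_smap : exists U : smap (sub K) X,
  forall m (d : sub K m), join_glue (sval d) (U m d).
Proof.
apply: (@rel_smap (sub K) X (fun m d z => join_glue (sval d) z)).
- by move=> m l a d z; apply: join_glue_act.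
- by move=> m [d Kd]; apply: join_glue_total.
- by move=> m d z z'; apply: join_glue_fun.
Qed.

End JoinGlue.

(** * Filling horns in mapping categories *)

Lemma rlp_simp (A : sset) n (i : smap A (simp n)) (X Y : sset) (f : smap X Y)
    (u : smap A X) (b : Y n) :
    rlp i f -> (forall m a, f m (u m a) = act (i m a) b) ->
  exists2 z : X n, f n z = b & forall m a, act (i m a) z = u m a.
Proof.
move=> /(_ u (simp_map b)) fl fu; have [//|h [hu hf]] := fl.
exists (h n (oid n)) => [|m a]; first by rewrite hf /= act_id.
by rewrite -hu -smap_act /= ocomp_id.
Qed.

Lemma lift_simp (A : scaled) n (T : set (simp n 2)) (i : scmap A (scale T)) (X Y : scaled)
    (f : scmap X Y) (u : scmap A X) (v : scmap (scale T) Y) (b : Y n) :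
    lifts i f u v -> (forall m (d : simp n m), v m d = act d b) ->
  exists2 z : X n, f n z = b & forall m a, act (i m a) z = u m a.
Proof.
move=> [h [hu hf]] vE.
exists (h n (oid n)) => [|m a]; first by rewrite hf vE act_id.
by rewrite -hu -smap_act /= ocomp_id.
Qed.

(** A horn Lambda^n_i in Hom(x, y) and the constant face on [n] glue to a map U on
    Lambda^(n+1)_i, so it is enough to fill horns of E of this kind. *)
Lemma hom_horn_filler (E B : scaled) (f : scmap E B) (x y : E 0) n (i : 'I_n.+1)
    (i' : 'I_(n + 1).+1) : 0 < n -> i' = i :> nat ->
    (forall (U : smap (sub (horn i')) E) (b : B (n + 1)),
      (forall m (d : sub (horn i') m), f m (U m d) = act (sval d) b) ->
      (forall m (d : sub (horn i') m), (forall k, sval d k <= n) -> U m d = cst m x) ->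
      act (ojoinl n 0) b = cst n (f 0 x) ->
      exists2 z : E (n + 1), f (n + 1) z = b &
        forall m (d : sub (horn i') m), act (sval d) z = U m d) ->
  rlp (incl (horn i)) (hom_map f x y).
Proof.
move=> n_gt0 ii' fill u v uv.
pose w := scomp (incl (hom_subc x y)) u.
have w_right m (c : sub (horn i) m) : act (ojoinr m 0) (w m c) = y.
  exact: (proj2_sig (u m c)).2.
have w_left m (c : sub (horn i) m) : act (ojoinl m 0) (w m c) = cst m x.
  exact: (proj2_sig (u m c)).1.
pose glue := @join_glue E n 0 (horn i) w y n (ojoinl n 0) (cst n x).
have g_left m l (c : sub (horn i) l) (d1 : omap m (l + 1)) d2 :
    ocomp (ojoin 0 (sval c)) d1 = ocomp (ojoinl n 0) d2 ->
  act d1 (w l c) = act d2 (cst n x).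
  move=> d12; rewrite act_cst.
  have [|d1' ->] := @ojoinl_factor l 0 m d1.
    by move=> k; rewrite -(ojoin_le (sval c)) -ocompE d12 ocompE ojoinl_le.
  by rewrite act_comp w_left act_cst.
have g_right m (d1 : omap m 0) d2 : ocomp (ojoinr n 0) d1 = ocomp (ojoinl n 0) d2 ->
    act d1 y = act d2 (cst n x).
  move=> d12; have := ojoinl_neq_ojoinr (d2 ord0) (d1 ord0).
  by rewrite -!ocompE d12 ocompE eqxx.
have g_inj := @ojoinl_inj n 0.
have glue_fun m (d : omap m (n + 1)) z z' : glue m d z -> glue m d z' -> z = z'.
  exact: join_glue_fun.
have [m d [j ji' dj]|U UR] := join_glue_smap w_right g_inj g_left g_right (K := horn i').
  case: (ojoin_left_case j) => [[a ja _]|[a ja _]]; last first.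
    left; apply: ojoinl_factor => k; have := dj k.
    case: (ojoin_left_case (d k)) => [[a' -> _] _|[a' -> _]]; first exact: ojoinl_le.
    by rewrite ja [a]ord1 [a']ord1 eqxx.
  right; exists a => [k|l c ca]; first by rewrite -ja.
  exists a => //; apply: contraNneq ji' => ai.
  by rewrite ja; apply/eqP/val_inj; rewrite ojoinlE /= ii' ai.
have [b_left b_right] := proj2_sig (v n (oid n)).
have vE m (d : simp n m) : sval (v m d) = act (ojoin 0 d) (sval (v n (oid n))).
  by rewrite -[in LHS](ocomp_id d) (smap_act v d (oid n)).
have [|||z fz zU] := fill U (sval (v n (oid n))).
- move=> m d; case: (UR m d) => [l c d' -> ->|d' -> ->|d' -> ->]; rewrite act_comp smap_act.
  + by have /(congr1 sval) /= -> := uv l c; rewrite vE.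
  + by rewrite b_right.
  + by rewrite b_left smap_cst.
- move=> m d /ojoinl_factor[d' e].
  by apply: glue_fun (UR m d) _; apply: JoinGlueFace e _; rewrite act_cst.
- exact: b_left.
have zR m (d : omap m (n + 1)) s : horn i' m d -> glue m d s -> act d z = s.
  by move=> hd; have /= -> := zU m (exist _ d hd); apply/glue_fun/(UR m (exist _ d hd)).
have zx : act (ojoinl n 0) z = cst n x.
  apply: zR; last exact: join_glue_face.
  exists (ojoinr n 0 ord0) => [|k]; last exact: ojoinl_neq_ojoinr.
  by rewrite -val_eqE /= ii' neq_ltn (leq_ltn_trans (leq_ord i) (ojoinr_gt n _)) orbT.
have zy : act (ojoinr n 0) z = y.
  apply: zR; last exact: join_glue_right.
  have [j ji] : exists j : 'I_n.+1, j != i.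
    case: (eqVneq i ord0) => [->|i0]; last by exists ord0; rewrite eq_sym.
    by exists ord_max; rewrite -val_eqE /= -lt0n.
  exists (ojoinl n 0 j) => [|k]; first by rewrite -val_eqE ojoinlE /= ii'.
  by rewrite eq_sym ojoinl_neq_ojoinr.
have z_hom : hom_subc x y n (z : dec 0 E n) by split.
exists (simp_map (exist (hom_subc x y n) z z_hom : hom x y n)); split=> [m c|m c].
  apply: sub_inj => /=; apply: zR; last exact: join_glue_left.
  case: (proj2_sig c) => j ji cj; exists (ojoinl n 0 j) => [|k].
    by rewrite -val_eqE ojoinlE /= ii'.
  case: (ojoin_left_case k) => [[a -> _]|[a -> _]].
    by rewrite ojoin_ojoinlE (inj_eq (@ojoinl_inj n 0)).
  by rewrite ojoin_ojoinrE eq_sym ojoinl_neq_ojoinr.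
by apply: sub_inj; rewrite vE /= smap_act fz.
Qed.

Lemma collapse_ext (X Y : sset) (A : subc X) (u : smap X Y) (v : Y 0) :
    (forall n s, A n s -> u n s = cst n v) ->
  exists u' : smap (collapse A) Y, (forall n s, u' n (to_collapse A n s) = u n s) /\
    forall n s, u' n (pclass (incl A) (to_pt (sub A)) (inr s)) = cst n v.
Proof.
move=> uA.
pose val n (s : X n + simp 0 n) := match s with inl s => u n s | inr _ => cst n v end.
have val_glue n s s' : glue (incl A) (to_pt (sub A)) s s' -> val n s = val n s'.
  elim=> {s s'} [s s' [a [-> ->]]|//|//|s s' s'' _ -> _ -> //].
  exact: uA (proj2_sig a).
pose R n (C : collapse A n) y := exists2 s, C = pclass (incl A) (to_pt (sub A)) s & y = val n s.
have Rfun n C y y' : R n C y -> R n C y' -> y = y'.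
  by move=> [s -> ->] [s' /pclassP ss' ->]; apply: val_glue.
have [|n C|u' hu'] := @rel_smap (collapse A) Y R _ _ Rfun.
- move=> m n a C y [s -> ->]; exists (sum_act a s); first by rewrite -pushout_actE.
  by case: s => s /=; rewrite ?smap_act ?act_cst.
- by have [s ->] := pclass_surj C; exists (val n s); exists s.
by exists u'; split=> n s; apply: Rfun (hu' _ _) _; [exists (inl s) | exists (inr s)].
Qed.

(** U and b descend to the collapsed horn and to the collapsed simplex because they are
    constant on the edge {j, k}. *)
Lemma collapsed_horn_filler (X Y : sset) (f : smap X Y) n (i : 'I_n.+1) (j k : nat)
    (U : smap (sub (horn i)) X) (b : Y n) (x : X 0) :
    rlp (collapsed_horn i j k) f ->
    (forall m d, f m (U m d) = act (sval d) b) ->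
    (forall m (d : sub (horn i) m), face n [:: j; k] m (sval d) -> U m d = cst m x) ->
    (forall m (d : simp n m), face n [:: j; k] m d -> act d b = cst m (f 0 x)) ->
  exists2 z : X n, f n z = b & forall m (d : sub (horn i) m), act (sval d) z = U m d.
Proof.
move=> fl fU Ux bx.
have [u [uU ux]] := collapse_ext (A := preim (incl (horn i)) (face n [:: j; k])) Ux.
have [v [vb vx]] := collapse_ext (A := face n [:: j; k]) (u := simp_map b) bx.
have [m C|h [hu hv]] := fl u v.
  have [[d|s] ->] := pclass_surj C; rewrite [X in v m X]collapse_map_funE.
    by apply: etrans (congr1 (@f m) (uU m d)) _; rewrite fU; apply: esym (vb m (sval d)).
  by rewrite ux vx smap_cst.
exists (h n (to_collapse (face n [:: j; k]) n (oid n))) => [|m d]; first by rewrite hv vb /= act_id.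
rewrite -uU -hu -smap_act -smap_act /= ocomp_id.
by rewrite [X in _ = h m X]collapse_map_funE.
Qed.

(** The lifting hypothesis is restricted to the given U, so that it also covers
    cartesian edges, which only provide lifts for horns with a prescribed last edge. *)
Lemma scaled_horn_filler (X Y : scaled) (f : scmap X Y) n (i : 'I_n.+1)
    (T : set (simp n 2)) (U : smap (sub (horn i)) X) (b : Y n) :
    (forall (u : scmap (scale (incl (horn i) 2 @^-1` T)) X) (v : scmap (scale T) Y),
      (forall m d, u m d = U m d) -> (forall m d, f m (u m d) = v m (sval d)) ->
      lifts (scaled_horn i T) f u v) ->
    (forall m d, f m (U m d) = act (sval d) b) ->
    (forall t : sub (horn i) 2, T (sval t) -> thin (U 2 t)) ->
    (forall t, T t -> thin (act t b)) ->
  exists2 z : X n, f n z = b & forall m (d : sub (horn i) m), act (sval d) z = U m d.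
Proof.
move=> fl fU UT bT.
have Uthin (t : scale (incl (horn i) 2 @^-1` T) 2) : thin t -> thin (U 2 t).
  by case=> [/UT //|[s [d ->]]]; rewrite smap_act; apply: thin_degen.
have bthin (t : scale T 2) : thin t -> thin (simp_map b 2 t).
  by case=> [/bT //|[s [d ->]]]; rewrite smap_act; apply: thin_degen.
pose u := @ScMap (scale (incl (horn i) 2 @^-1` T)) X U Uthin.
pose v := @ScMap (scale T) Y (simp_map b) bthin.
have uv := fl u v (fun _ _ => erefl) fU.
exact: (lift_simp uv).
Qed.

Lemma thin_cst (X : scaled) (x : X 0) : thin (cst 2 x : X 2).
Proof. by rewrite -(act_cst odeg x); apply: thin_degen. Qed.

Lemma hom_map_detects_marked (E B : scaled) (f : scmap E B) (x y : E 0) :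
  detects_thin f -> detects_marked (hom_map f x y).
Proof. by move=> ft e; apply: (ft (sval e)). Qed.

Lemma cst_left (X : sset) n (b : X (n + 1)) (v : X 0) m (d : omap m (n + 1)) :
  act (ojoinl n 0) b = cst n v -> (forall k, d k <= n) -> act d b = cst m v.
Proof.
move=> bv dn.
have [d' ->] := ojoinl_factor dn.
by rewrite act_comp bv act_cst.
Qed.

Lemma hom_map_left_fibration (E B : scaled) (f : scmap E B) (x y : E 0) :
  outer_fibration f -> marked_left_fibration (hom_map f x y).
Proof.
case=> [[f_inner _ _]] ft f_left _; split; first exact: hom_map_detects_marked.
move=> n i /andP[_ lt_in].
have n_gt0 := leq_ltn_trans (leq0n i) lt_in.
have i'P : i < (n + 1).+1 by rewrite addn1 ltnS ltnW // ltnW.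
apply: (@hom_horn_filler _ _ _ _ _ _ _ (Ordinal i'P)) => // U b fU Ux bx.
have bx' m (d : omap m (n + 1)) := cst_left (d := d) bx.
(* For i = 0 the horn collapses along {0, 1}, which lies in [n] because n > 0. *)
case: (posnP i) => [i0|i_gt0].
  have e : Ordinal i'P = ord0 by apply: val_inj.
  case: _ / (esym e) U fU Ux => U fU Ux.
  have face_le m (d : simp (n + 1) m) : face (n + 1) [:: 0; 1] m d -> forall k, d k <= n.
    by move=> hd k; have := hd k; rewrite !inE => /orP[] /eqP ->.
  apply: (collapsed_horn_filler (x := x)) fU _ _; first by apply: f_left; rewrite addn1.
    by move=> m d /face_le; apply: Ux.
  by move=> m d /face_le; apply: bx'.
(* For 0 < i < n the triangle {i-1, i, i+1} lies in [n], where everything is constant. *)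
have tri_le (t : simp (n + 1) 2) : tri (n + 1) i.-1 i i.+1 t -> forall k, t k <= n.
  case=> _ _ tmax k.
  have k_max : k <= (ord_max : 'I_3) by apply: leq_ord.
  by apply: leq_trans (omap_le t k_max) _; rewrite tmax.
apply: scaled_horn_filler fU _ _.
- by move=> u v _; apply: f_inner; rewrite i_gt0 /= addn1 ltnS ltnW.
- by move=> t /tri_le/Ux ->; apply: thin_cst.
- by move=> t /tri_le/bx' ->; apply: thin_cst.
Qed.

Lemma hom_map_right_fibration (E B : scaled) (f : scmap E B) (x y : E 0) :
  inner_fibration f -> marked_right_fibration (hom_map f x y).
Proof.
case=> _ ft f_inner; split; first exact: hom_map_detects_marked.
move=> n i /andP[i_gt0 le_in].
have n_gt0 := leq_trans i_gt0 le_in.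
have i'P : i < (n + 1).+1 by rewrite addn1 ltnS ltnW.
apply: (@hom_horn_filler _ _ _ _ _ _ _ (Ordinal i'P)) => // U b fU _ _.
have := rlp_simp (f_inner _ (Ordinal i'P) _) fU.
by apply; rewrite /= i_gt0 addn1 ltnS.
Qed.

(** * The legs of the post-composition zig-zag *)

Lemma ojoin_vertex_ojoinlE n j i : ojoin_vertex n j (ojoinl n 0 i) = ojoinl n 1 i.
Proof. by rewrite !ojoinlE ojoin_vertex_l. Qed.

Lemma ojoin_vertex_ojoinrE n j i : ojoin_vertex n j (ojoinr n 0 i) = ojoinr n 1 j.
Proof. by rewrite !ojoinrE ojoin_vertex_r. Qed.

Lemma ojoin_vertex_inj n j : injective (ojoin_vertex n j).
Proof.
move=> a b; case: (ojoin_left_case a) => [[i -> _]|[i -> _]];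
    case: (ojoin_left_case b) => [[i' -> _]|[i' -> _]];
    rewrite ?ojoin_vertex_ojoinlE ?ojoin_vertex_ojoinrE.
- by move=> /(@ojoinl_inj n 1) ->.
- by move=> /eqP; rewrite (negPf (ojoinl_neq_ojoinr _ _)).
- by move=> /eqP; rewrite eq_sym (negPf (ojoinl_neq_ojoinr _ _)).
- by rewrite [i]ord1 [i']ord1.
Qed.

Lemma ojoin_vertex_case n j (a : 'I_(n + 2).+1) :
  (exists i, a = ojoin_vertex n j i) \/ (exists2 j', j' != j & a = ojoinr n 1 j').
Proof.
case: (ojoin_left_case a) => [[i -> _]|[i -> _]].
  by left; exists (ojoinl n 0 i); rewrite ojoin_vertex_ojoinlE.
case: (eqVneq i j) => [->|ij]; last by right; exists i.
by left; exists (ojoinr n 0 ord0); rewrite ojoin_vertex_ojoinrE.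
Qed.

Lemma ojoin_vertex_neq n j j' a : j' != j -> ojoin_vertex n j a != ojoinr n 1 j'.
Proof.
move=> jj'; case: (ojoin_left_case a) => [[i -> _]|[i -> _]].
  by rewrite ojoin_vertex_ojoinlE ojoinl_neq_ojoinr.
by rewrite ojoin_vertex_ojoinrE (inj_eq (@ojoinr_inj n 1)) eq_sym.
Qed.

Section SliceFiber.

Context (E B : scaled) (f : scmap E B) (x x' : E 0) (e : E 1).
Context (hs : source e = x') (hx : f 0 x' = f 0 x) (f_thin : detects_thin f).

(** The simplex of shape [n] * [1] of B, degenerate on f e, over which the fiber lies *)
Local Notation base n :=
  (act (ojoin 1 (ocst n (ord0 : 'I_1))) (act odeg (f 1 e) : B (0 + 2)) : B (n + 2)).

Lemma base_thin n (d : omap 2 (n + 2)) : thin (act d (base n)).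
Proof. by rewrite -!act_comp; apply: thin_degen. Qed.

Lemma base_ojoin m n (c : omap m n) : act (ojoin 1 c) (base n) = base m.
Proof.
rewrite -act_comp -ojoin_comp; congr (act (ojoin 1 _) _).
by apply: omapP => i; rewrite ocompE !mk_omapE.
Qed.

Lemma base_right n : act (ojoinr n 1) (base n) = f 1 e.
Proof. by rewrite -!act_comp ojoin_ojoinr odeg_ojoinr act_id. Qed.

(** The boundary of an n-simplex of the fiber and a lift t of its j-th leg glue to a map
    on the horn of Delta^(n+2) at the vertex n+1+j: the missing face is opposite to that
    vertex, and t is the face opposite to the other vertex of [1]. Both legs are treated
    at once; they differ in the reason why this horn has a filler over base n. *)
Lemma slice_fiber_filler n (j : 'I_2) (i : 'I_(n + 2).+1) (T : set (simp (n + 2) 2))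
    (W : smap (sub (boundary n)) (slice_fiber hs hx)) (t : E (n + 1)) :
    i = n.+1 + j :> nat ->
    (forall (u : scmap (scale (incl (horn i) 2 @^-1` T)) E) (v : scmap (scale T) B),
      (forall m d, f m (u m d) = v m (sval d)) ->
      (forall d : sub (horn i) 1, edge (n + 2) (n + 2).-1 (n + 2) (sval d) -> u 1 d = e) ->
      lifts (scaled_horn i T) f u v) ->
    act (ojoinl n 0) t = cst n x -> act (ojoinr n 0) t = act (ocst 0 j) e ->
    f (n + 1) t = act (ojoin_vertex n j) (base n) ->
    (forall m (c : sub (boundary n) m),
      act (ojoin_vertex m j) (sval (sval (W m c)) : E (m + 2)) = act (ojoin 0 (sval c)) t) ->
  exists2 s : slice_fiber hs hx n,
    act (ojoin_vertex n j) (sval (sval s) : E (n + 2)) = t &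
    forall m (c : sub (boundary n) m), act (sval c) s = W m c.
Proof.
move=> ij fl tl tr ft Wt.
pose w : smap (sub (boundary n)) (dec 1 E) := scomp (incl _) (scomp (incl _) W).
have fw m (c : sub (boundary n) m) : f (m + 2) (w m c) = base m.
  exact: (congr1 sval (proj2_sig (W m c))).
have w_right m (c : sub (boundary n) m) : act (ojoinr m 1) (w m c) = e.
  by have [] := proj2_sig (sval (W m c)).
have g_inj := @ojoin_vertex_inj n j.
have g_left m l (c : sub (boundary n) l) (d1 : omap m (l + 2)) d2 :
    ocomp (ojoin 1 (sval c)) d1 = ocomp (ojoin_vertex n j) d2 ->
  act d1 (w l c) = act d2 t.
  move=> d12.
  have [|k|d1' e1] := @omap_factor _ _ _ (ojoin_vertex l j) d1; first exact: ojoin_vertex_inj.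
    case: (ojoin_vertex_case j (d1 k)) => [//|[j' jj' dk]].
    have := ojoin_vertex_neq (d2 k) jj'.
    by rewrite -ocompE -d12 ocompE dk ojoin_ojoinrE eqxx.
  move: d12; rewrite e1 ocompA ojoin_vertex_nat -ocompA => /(ocomp_inj g_inj) <-.
  by rewrite !act_comp; congr act; apply: Wt.
have g_right m (d1 : omap m 1) d2 :
    ocomp (ojoinr n 1) d1 = ocomp (ojoin_vertex n j) d2 -> act d1 e = act d2 t.
  move=> d12.
  have [k|d2' e2] := @ojoinr_factor n 0 m d2.
    case: (ojoin_left_case (d2 k)) => [[a dk _]|[//]].
    have := ojoinl_neq_ojoinr a (d1 k).
    by rewrite -(ocompE (ojoinr n 1)) d12 ocompE dk ojoin_vertex_ojoinlE eqxx.
  move: d12; rewrite e2 ocompA ojoin_vertex_ojoinr -ocompA.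
  move=> /(ocomp_inj (@ojoinr_inj n 1)) ->.
  by rewrite !act_comp tr.
pose glue := @join_glue E n 1 (boundary n) w e (n + 1) (ojoin_vertex n j) t.
have glue_fun m (d : omap m (n + 2)) z z' : glue m d z -> glue m d z' -> z = z'.
  exact: join_glue_fun.
have iE : i = ojoinr n 1 j by apply: val_inj; rewrite ojoinrE.
have [m d [a ai da]|U UR] := join_glue_smap w_right g_inj g_left g_right (K := horn i).
  case: (ojoin_left_case a) => [[b ab _]|[b ab _]].
    by right; exists b => [k|l c cb]; [rewrite -ab | exists b].
  left; apply: omap_factor g_inj _ => k.
  case: (ojoin_vertex_case j (d k)) => [//|[j' jj' dk]].
  have bj : b != j by apply: contraNneq ai => bj; rewrite ab bj iE.
  have bj' : b = j'.
    by apply: val_inj; move: bj jj'; clear; case: b j j' => [[|[|?]] ?] [[|[|?]] ?] [[|[|?]] ?].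
  by have := da k; rewrite dk ab bj' eqxx.
have fU m (d : sub (horn i) m) : f m (U m d) = act (sval d) (base n).
  case: (UR m d) => [l c d' -> ->|d' -> ->|d' -> ->]; rewrite act_comp smap_act.
  - by rewrite fw base_ojoin.
  - by rewrite base_right.
  - by rewrite ft.
have U_edge (d : sub (horn i) 1) : edge (n + 2) (n + 2).-1 (n + 2) (sval d) -> U 1 d = e.
  case=> d0 d1; have de : sval d = ojoinr n 1.
    apply: omapP => k; apply: val_inj; rewrite ojoinrE /=.
    case: k => [[|[|//]] kP].
      by rewrite (_ : Ordinal kP = ord0) ?d0 ?addn2 ?addn0 //; apply: val_inj.
    by rewrite (_ : Ordinal kP = ord_max) ?d1 ?addn2 ?addn1 //; apply: val_inj.
  by apply: glue_fun (UR 1 d) _; rewrite de; apply: join_glue_right.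
have [|||z fz zU] := @scaled_horn_filler _ _ f _ i T U (base n) _ fU.
- by move=> u v uU uv; apply: fl => // d; rewrite uU; apply: U_edge.
- by move=> d _; apply/f_thin; rewrite fU; apply: base_thin.
- by move=> d _; apply: base_thin.
have zR m (d : omap m (n + 2)) s : horn i m d -> glue m d s -> act d z = s.
  by move=> hd; have /= -> := zU m (exist _ d hd); apply/glue_fun/(UR m (exist _ d hd)).
have zt : act (ojoin_vertex n j) z = t.
  apply: zR; last exact: join_glue_face.
  have [j' jj'] : exists j' : 'I_2, j' != j.
    by case: (eqVneq j ord0) => [->|j0]; [exists ord_max | exists ord0; rewrite eq_sym].
  exists (ojoinr n 1 j') => [|k]; last exact: ojoin_vertex_neq.
  by rewrite iE (inj_eq (@ojoinr_inj n 1)).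
have ze : act (ojoinr n 1) z = e.
  apply: zR; last exact: join_glue_right.
  by exists (ojoinl n 1 ord0) => [|k]; rewrite ?iE 1?[_ == ojoinl _ _ _]eq_sym ojoinl_neq_ojoinr.
have zx : act (ojoinl n 1) z = cst n x.
  by rewrite -(ojoin_vertex_ojoinl n j) act_comp zt tl.
have z_slice : slice_subc x e n (z : dec 1 E n).
  split=> // k; apply/f_thin; rewrite smap_act fz; exact: base_thin.
pose s : slice x e n := exist (slice_subc x e n) z z_slice.
have s_fiber : preim (slice_map f x e) (point (slice_id (postcomp_source hs hx))) n s.
  by apply: sub_inj.
exists (exist _ s s_fiber) => // m c; apply: sub_inj; apply: sub_inj => /=.
apply: zR; last exact: join_glue_left.
case: (proj2_sig c) => b cb; exists (ojoinl n 1 b) => [|k]; first by rewrite iE ojoinl_neq_ojoinr.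
case: (ojoin_left_case k) => [[a -> _]|[a -> _]].
  by rewrite ojoin_ojoinlE (inj_eq (@ojoinl_inj n 1)).
by rewrite ojoin_ojoinrE eq_sym ojoinl_neq_ojoinr.
Qed.

Lemma base_vertex n j :
  act (ojoin_vertex n j) (base n) =
  act (ojoin 0 (ocst n ord0)) (act (ojoin_vertex 0 j) (act odeg (f 1 e) : B (0 + 2))).
Proof. by rewrite -!act_comp ojoin_vertex_nat. Qed.

(** The horn is Lambda^(n+2)_(n+1), an inner one. *)
Lemma postcomp_left_trivial : weak_fibration f ->
  trivial_fibration (postcomp_left hs hx).
Proof.
case=> f_inner _ _ n w a wa.
pose t : E (n + 1) := sval (sval a).
have [al ar] := proj2_sig a.
have iP : n.+1 < (n + 2).+1 by rewrite addn2 ltnS.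
have [|||||| s st sw] := @slice_fiber_filler n ord0 (Ordinal iP) (tri (n + 2) n n.+1 n.+2) w t.
- by rewrite /= addn0.
- by move=> u v uv _; apply: f_inner uv; rewrite /= addn2 ltnSn.
- exact: (congr1 sval al).
- exact: etrans (congr1 sval ar) (esym hs).
- rewrite [LHS](proj2_sig (sval a)) -(postcomp_source hs hx) base_vertex /source /cst -!act_comp.
  (* Both vertices of the image, in [n] and in [0], are the source of f e. *)
  congr act; apply: (@ojoin_ext n 0) => k; rewrite !ocompE.
    by rewrite ojoin_l ojoin_vertex_l !mk_omapE; apply: val_inj; rewrite /= inordK.
  by rewrite ojoin_r ojoin_vertex_r !mk_omapE; apply: val_inj; rewrite /= inordK.
- by move=> m c; have /(congr1 (fun s => sval (sval s))) := wa m c.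
by exists s => //; apply: sub_inj; apply: sub_inj.
Qed.

(** The horn is Lambda^(n+2)_(n+2), and its last edge is the cartesian edge e. *)
Lemma postcomp_right_trivial (y : E 0) (ht : target e = y) : cartesian_edge f e ->
  trivial_fibration (postcomp_right hs ht hx).
Proof.
move=> e_cart n w a wa.
pose t : E (n + 1) := sval (sval a).
have [al ar] := proj2_sig (sval a).
have [|||||| s st sw] :=
    @slice_fiber_filler n ord_max ord_max (tri (n + 2) 0 (n + 2).-1 (n + 2)) w t.
- by rewrite /= addn1 addn2.
- by move=> u v uv ue; apply: e_cart => //; rewrite addn2.
- exact: al.
- exact: etrans ar (esym ht).
- rewrite base_vertex [LHS](congr1 sval (proj2_sig a)).
  congr act; apply: esym.
  exact: (congr1 sval (slice_target_id (postcomp_source hs hx) (postcomp_target f ht))).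
- by move=> m c; have /(congr1 (fun s => sval (sval s))) := wa m c.
by exists s => //; apply: sub_inj; apply: sub_inj.
Qed.

End SliceFiber.

Theorem proposition2p2p1 (E B : scaled) (f : scmap E B) (hE : bicategory E)
  (hB : bicategory B) (x y : E 0) :
  (outer_fibration f -> marked_left_fibration (hom_map f x y)) /\
  (inner_fibration f -> marked_right_fibration (hom_map f x y)) /\
  (outer_fibration f \/ inner_fibration f ->
   forall (x' : E 0) (e : E 1) (hs : source e = x') (ht : target e = y)
     (hx : f 0 x' = f 0 x),
     cartesian_edge f e ->
     zigzag_equivalence (postcomp_left hs hx) (postcomp_right hs ht hx)).
Proof.
split; first exact: hom_map_left_fibration.
split; first exact: hom_map_right_fibration.
move=> f_fib x' e hs ht hx e_cart.
have [f_weak f_thin] : weak_fibration f /\ detects_thin f.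
  by case: f_fib => [[? ? _ _]|[? ? _]].
apply: zigzag_trivial_fibrations; first exact: postcomp_left_trivial.
exact: postcomp_right_trivial.
Qed.
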